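(* Balanced Cluster Editing restricted to instances $(G,k,\eta)$ in which $G$ is a cluster graph admits an algorithm running in time $2^{\mathcal{O}(k)}n^{\mathcal{O}(1)}$, where $n=|V(G)|$.
   Context: All graphs are finite and simple. A cluster graph is a graph in which every connected component is a clique. For a non-negative integer $\eta$, a graph is $\eta$-balanced if for any two connected components $H,H'$ we have $\big||V(H)|-|V(H')|\big|\le\eta$. Balanced Cluster Editing: given a graph $G$ and non-negative integers $k,\eta$, decide whether there is $F\subseteq\binom{V(G)}{2}$ with $|F|\le k$ such that the graph $(V(G),E(G)\triangle F)$ is an $\eta$-balanced cluster graph. *)

(* Defs.v *)
From mathcomp Require Import all_boot all_order all_algebra.
Set Implicit Arguments.
Unset Strict Implicit.
Unset Printing Implicit Defensive.

(* A finite simple graph is a finType V of vertices together with an edge set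
   E : {set {set V}} such that E \subset vpairs V. *)
Section Graphs.
Variable V : finType.
Implicit Types (E F : {set {set V}}) (H : {set V}).

Definition vpairs : {set {set V}} := [set A : {set V} | #|A| == 2].

Definition adj E : rel V := fun x y => [set x; y] \in E.

Definition components E : {set {set V}} :=
  [set [set y | connect (adj E) x y] | x : V].

Definition clique E H : Prop :=
  forall x y, x \in H -> y \in H -> x != y -> adj E x y.

Definition cluster_graph E : Prop :=
  forall H, H \in components E -> clique E H.

Definition balanced (eta : nat) E : Prop :=
  forall H H', H \in components E -> H' \in components E ->
    (`| #|H| - #|H'| | <= eta)%N.

Definition symdiff E F : {set {set V}} := (E :\: F) :|: (F :\: E).

Definition balanced_cluster_editing E (k eta : nat) : Prop :=
  exists F : {set {set V}},
    [/\ F \subset vpairs, #|F| <= k,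
        cluster_graph (symdiff E F) & balanced eta (symdiff E F)].

End Graphs.

(* Random access machine under the uniform cost measure.  A program uses
   finitely many registers and an unbounded memory, all holding naturals.  The
   only arithmetic is addition and truncated subtraction: with multiplication
   at unit cost the machine would no longer be polynomially equivalent to
   Turing machines. *)
Inductive instr : Type :=
  | IConst of nat & nat          (* IConst i c : r_i := c *)
  | IAdd of nat & nat & nat      (* IAdd i j l : r_i := r_j + r_l *)
  | ISub of nat & nat & nat      (* ISub i j l : r_i := r_j - r_l, truncated *)
  | IRead of nat & nat           (* IRead i j : r_i := memory[r_j] *)
  | IWrite of nat & nat          (* IWrite i j : memory[r_i] := r_j *)
  | IJump of nat                 (* IJump p : goto p *)
  | IJumpZero of nat & nat       (* IJumpZero i p : if r_i = 0 then goto p *)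
  | IHalt.

Definition program := seq instr.

Record config := Config { pc : nat; regs : nat -> nat; memory : nat -> nat }.

(* Leaving the program text halts. *)
Definition current (P : program) (s : config) : instr := nth IHalt P (pc s).

Definition step (P : program) (s : config) : config :=
  let: Config p r m := s in
  match current P s with
  | IConst i c => Config p.+1 [eta r with i |-> c] m
  | IAdd i j l => Config p.+1 [eta r with i |-> r j + r l] m
  | ISub i j l => Config p.+1 [eta r with i |-> r j - r l] m
  | IRead i j => Config p.+1 [eta r with i |-> m (r j)] m
  | IWrite i j => Config p.+1 r [eta m with r i |-> r j]
  | IJump q => Config q r m
  | IJumpZero i q => Config (if r i == 0 then q else p.+1) r m
  | IHalt => s
  end.

Definition init (x : seq nat) : config := Config 0 (fun=> 0) (nth 0 x).

(* P halts on x after at most t steps, with the bit b in register 0.  A halted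
   configuration is a fixed point of step, hence "at most". *)
Definition outputs_within (P : program) (x : seq nat) (t : nat) (b : bool) :
    Prop :=
  let s := iter t (step P) (init x) in current P s = IHalt /\ regs s 0 = b.

(* Order of the graph, k, eta, then the adjacency matrix row by row. *)
Definition encode (V : finType) (E : {set {set V}}) (k eta : nat) : seq nat :=
  [:: #|V|; k; eta] ++ [seq nat_of_bool (adj E x y) | x <- enum V, y <- enum V].

(* Main.v *)
Require Import Defs.
From mathcomp Require Import all_boot all_order all_algebra.
From mathcomp Require Import zify.
Set Implicit Arguments.
Unset Strict Implicit.
Unset Printing Implicit Defensive.

(* A cluster graph is edited into another one along a path of splits of one
   cluster into two and merges of two clusters into one: first split every
   cluster along the target clusters, then merge.  A step on parts of sizes x
   and y costs x * y edits, and along this path no pair is edited twice, so the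
   costs add up to the edit distance; for arbitrary paths the sum bounds the
   distance from above.  Whether a step is possible depends only on the multiset
   of cluster sizes.  As x + y <= 2 * x * y, writing x and y in unary takes
   O(x * y) digits, so a cheapest solution has a description by 3 * k digits in
   base 4, and a RAM can try all of the 2^(6 * k) descriptions. *)

(** * A loop language compiled to the RAM *)

(** Trying edit sets directly would put n into the base of the exponential; keeping only cluster
    sizes removes it. Unary digits have a second use: they let the machine pay x * y by repeated
    addition, as it cannot multiply. Every loop has a bound fixed before it starts, so the running
    time can be read off the program text. For the same reason a description that asks for a missing
    cluster is not abandoned: it raises a fault count and is run to its end. Since all strings of 3
    * k digits are simulated, meaningless ones included, soundness must hold for arbitrary strings:
    a fault-free run has to end in the size histogram of some cluster graph within the cost paid,
    and a faulty run must not leave nonzero values beyond its own histogram. *)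

Inductive cmd :=
  | Skip
  | Op of instr
  | Seq of cmd & cmd
  | IfZero of nat & cmd & cmd
  | Loop of nat & nat & cmd.

Notation "a ;; b" := (Seq a b) (at level 80, right associativity).

Definition state : Type := (nat -> nat) * (nat -> nat).

Definition upd (f : nat -> nat) i v : nat -> nat := [eta f with i |-> v].
Arguments upd f i v j /.

Definition exec (a : instr) (s : state) : state :=
  match a with
  | IConst i c => (upd s.1 i c, s.2)
  | IAdd i j l => (upd s.1 i (s.1 j + s.1 l), s.2)
  | ISub i j l => (upd s.1 i (s.1 j - s.1 l), s.2)
  | IRead i j => (upd s.1 i (s.2 (s.1 j)), s.2)
  | IWrite i j => (s.1, upd s.2 (s.1 i) (s.1 j))
  | _ => s
  end.

(* Register 1 is a scratch register: loops use it to copy and to decrement. *)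
Definition loop_init i j (s : state) : state :=
  exec (IAdd i j 1) (exec (IConst 1 0) s).

Definition loop_dec i (s : state) : state :=
  exec (ISub i i 1) (exec (IConst 1 1) s).

Fixpoint run (c : cmd) (s : state) : state :=
  match c with
  | Skip => s
  | Op a => exec a s
  | Seq c1 c2 => run c2 (run c1 s)
  | IfZero i c1 c2 => if s.1 i == 0 then run c1 s else run c2 s
  | Loop i j c => iter (s.1 j) (fun s => run c (loop_dec i s)) (loop_init i j s)
  end.

Fixpoint code_size (c : cmd) : nat :=
  match c with
  | Skip => 0
  | Op _ => 1
  | Seq c1 c2 => code_size c1 + code_size c2
  | IfZero _ c1 c2 => code_size c1 + code_size c2 + 2
  | Loop _ _ c => code_size c + 6
  end.

(* Jump targets are absolute, hence the address [p] of the code. *)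
Fixpoint compile (p : nat) (c : cmd) : program :=
  match c with
  | Skip => [::]
  | Op a => [:: a]
  | Seq c1 c2 => compile p c1 ++ compile (p + code_size c1) c2
  | IfZero i c1 c2 =>
      IJumpZero i (p + code_size c2 + 2) :: compile p.+1 c2 ++
      IJump (p + code_size c2 + code_size c1 + 2) ::
      compile (p + code_size c2 + 2) c1
  | Loop i j c =>
      [:: IConst 1 0; IAdd i j 1; IJumpZero i (p + code_size c + 6);
          IConst 1 1; ISub i i 1] ++
      compile (p + 5) c ++ [:: IJump (p + 2)]
  end.

Definition target (a : instr) : seq nat :=
  match a with
  | IConst i _ | IAdd i _ _ | ISub i _ _ | IRead i _ => [:: i]
  | _ => [::]
  end.

Fixpoint written (c : cmd) : seq nat :=
  match c with
  | Skip => [::]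
  | Op a => target a
  | Seq c1 c2 => written c1 ++ written c2
  | IfZero _ c1 c2 => written c1 ++ written c2
  | Loop i _ c => 1 :: i :: written c
  end.

Fixpoint loop_bounds (c : cmd) : seq nat :=
  match c with
  | Skip | Op _ => [::]
  | Seq c1 c2 => loop_bounds c1 ++ loop_bounds c2
  | IfZero _ c1 c2 => loop_bounds c1 ++ loop_bounds c2
  | Loop _ j c => j :: loop_bounds c
  end.

Definition straight (a : instr) : bool :=
  match a with IJump _ | IJumpZero _ _ | IHalt => false | _ => true end.

Fixpoint well_formed (c : cmd) : bool :=
  match c with
  | Skip => true
  | Op a => straight a
  | Seq c1 c2 => well_formed c1 && well_formed c2
  | IfZero _ c1 c2 => well_formed c1 && well_formed c2
  | Loop i j c => [&& i != 1, j != 1, i \notin written c & well_formed c]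
  end.

(** No loop bound is ever overwritten, so [cost] evaluated on the initial registers stays valid at
    every later moment, in particular in each iteration of an outer loop. *)
Definition stable (c : cmd) : bool :=
  well_formed c && ~~ has (mem (written c)) (loop_bounds c).

(** An upper bound, not the exact time: both branches of a test are charged, so that the value
    depends only on the registers that bound loops. An iteration costs four instructions of
    overhead, a loop three more for copying the bound and for the last test. *)
Fixpoint cost (c : cmd) (r : nat -> nat) : nat :=
  match c with
  | Skip => 0
  | Op _ => 1
  | Seq c1 c2 => cost c1 r + cost c2 r
  | IfZero _ c1 c2 => cost c1 r + cost c2 r + 2
  | Loop _ j c => r j * (cost c r + 4) + 3
  end.

Lemma size_compile p c : size (compile p c) = code_size c.
Proof.
elim: c p => //= [c1 IH1 c2 IH2|_ c1 IH1 c2 IH2|_ _ c IH] p.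
- by rewrite size_cat IH1 IH2.
- by rewrite size_cat /= IH1 IH2; lia.
- by rewrite size_cat /= IH; lia.
Qed.

Lemma exec_unwritten a s j : j \notin target a -> (exec a s).1 j = s.1 j.
Proof.
case: s => r m; case: a => //= [i c|i l l'|i l l'|i l];
  by rewrite inE => /negPf ->.
Qed.

Lemma run_unwritten c s j : j \notin written c -> (run c s).1 j = s.1 j.
Proof.
elim: c s => //= [a|c1 IH1 c2 IH2|i c1 IH1 c2 IH2|i l c IH] s.
- exact: exec_unwritten.
- by rewrite mem_cat negb_or => /andP[? ?]; rewrite IH2 // IH1.
- by rewrite mem_cat negb_or => /andP[? ?]; case: ifP => _; rewrite ?IH2 ?IH1.
- rewrite !inE !negb_or => /and3P[/negPf n1 /negPf n2 nw].
  elim: (s.1 l) => [|q IHq] /=; first by case: s => r m /=; rewrite n1 n2.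
  rewrite IH // -IHq; case: (iter q _ _) => r m /=.
  by rewrite n1 n2.
Qed.

Lemma eq_cost c r r' : {in loop_bounds c, r =1 r'} -> cost c r = cost c r'.
Proof.
elim: c => //= [c1 IH1 c2 IH2|_ c1 IH1 c2 IH2|_ j c IH] eqr.
- by rewrite IH1 ?IH2 // => i Hi; apply: eqr; rewrite mem_cat Hi ?orbT.
- by rewrite IH1 ?IH2 // => i Hi; apply: eqr; rewrite mem_cat Hi ?orbT.
- by rewrite eqr ?mem_head // IH // => i Hi; apply: eqr; rewrite inE Hi orbT.
Qed.

(** * Simulation of compiled code by the machine *)

Definition reaches P (T : nat) (u v : config) : Prop :=
  exists2 t, t <= T & iter t (step P) u = v.

Lemma reaches_refl P T u : reaches P T u u.
Proof. by exists 0. Qed.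

Lemma reaches_trans P T1 T2 u v w :
  reaches P T1 u v -> reaches P T2 v w -> reaches P (T1 + T2) u w.
Proof.
move=> [t1 l1 e1] [t2 l2 e2]; exists (t2 + t1); first by lia.
by rewrite iterD e1.
Qed.

Lemma reaches_leq P T T' u v : T <= T' -> reaches P T u v -> reaches P T' u v.
Proof. by move=> le_T [t lt e]; exists t => //; apply: leq_trans le_T. Qed.

Lemma reaches_step P u v : step P u = v -> reaches P 1 u v.
Proof. by move=> <-; exists 1. Qed.

Definition config_at (p : nat) (s : state) : config := Config p s.1 s.2.

Definition code_at (P : program) (p : nat) (code : program) : Prop :=
  forall i, i < size code -> nth IHalt P (p + i) = nth IHalt code i.

Lemma code_at_cat P p c1 c2 :
  code_at P p (c1 ++ c2) -> code_at P p c1 /\ code_at P (p + size c1) c2.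
Proof.
move=> H; split=> i Hi.
  by rewrite H ?size_cat ?nth_cat ?Hi //; lia.
rewrite -addnA H ?size_cat ?ltn_add2l // nth_cat ltnNge leq_addr /=.
by rewrite addKn.
Qed.

Lemma code_at_cons P p a c :
  code_at P p (a :: c) -> nth IHalt P p = a /\ code_at P p.+1 c.
Proof.
rewrite -cat1s => /code_at_cat[H1 H2]; split; last by rewrite -addn1.
by have := H1 0 isT; rewrite addn0.
Qed.

Lemma reaches_exec P p a s : straight a -> nth IHalt P p = a ->
  reaches P 1 (config_at p s) (config_at p.+1 (exec a s)).
Proof.
move=> st Pp; apply: reaches_step; case: s => r m; rewrite /step /current /= Pp.
by case: a st {Pp}.
Qed.

Lemma reaches_jump P p q s : nth IHalt P p = IJump q ->
  reaches P 1 (config_at p s) (config_at q s).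
Proof. by move=> H; apply: reaches_step; rewrite /step /current H. Qed.

Lemma reaches_jump_zero P p i q s : nth IHalt P p = IJumpZero i q ->
  reaches P 1 (config_at p s) (config_at (if s.1 i == 0 then q else p.+1) s).
Proof. by move=> H; apply: reaches_step; rewrite /step /current H. Qed.

Lemma stable_seq c1 c2 : stable (c1 ;; c2) ->
  [/\ stable c1, stable c2 & {in loop_bounds c2, forall j, j \notin written c1}].
Proof.
rewrite /stable /= has_cat negb_or => /andP[/andP[-> ->]] /andP[/hasPn h1 /hasPn h2].
split.
- by apply/hasPn => j /h1; rewrite /= mem_cat negb_or => /andP[].
- by apply/hasPn => j /h2; rewrite /= mem_cat negb_or => /andP[].
- by move=> j /h2; rewrite /= mem_cat negb_or => /andP[].
Qed.

Lemma compile_correct P c p s : stable c -> code_at P p (compile p c) ->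
  reaches P (cost c s.1) (config_at p s) (config_at (p + code_size c) (run c s)).
Proof.
elim: c p s => [|a|c1 IH1 c2 IH2|i c1 IH1 c2 IH2|i j c IH] p s.
- by move=> _ _ /=; rewrite addn0; apply: reaches_refl.
- move=> /andP[/= st _] /code_at_cons[Pp _].
  by rewrite addn1; apply: reaches_exec.
- move=> /stable_seq[st1 st2 fr] /= /code_at_cat[]; rewrite size_compile => C1 C2.
  apply: reaches_trans (IH1 _ _ st1 C1) _.
  rewrite addnA -(@eq_cost c2 (run c1 s).1); first exact: IH2.
  by move=> l /fr; apply: run_unwritten.
- move=> /(@stable_seq c1 c2)[st1 st2 _] /= /code_at_cons[Pp] /code_at_cat[C2].
  rewrite size_compile => /code_at_cons[Pj C1].
  have := reaches_jump_zero s Pp; case: ifP => _ R1.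
    apply: (@reaches_leq _ (1 + cost c1 s.1)); first by lia.
    apply: reaches_trans R1 _.
    have -> : p + (code_size c1 + code_size c2 + 2) =
      p + code_size c2 + 2 + code_size c1 by lia.
    apply: IH1 => //.
    have e : (p.+1 + code_size c2).+1 = p + code_size c2 + 2 by lia.
    by rewrite e in C1.
  apply: (@reaches_leq _ (1 + (cost c2 s.1 + 1))); first by lia.
  apply: reaches_trans R1 _; apply: reaches_trans (IH2 _ _ st2 C2) _.
  have -> : p + (code_size c1 + code_size c2 + 2) = p + code_size c2 + code_size c1 + 2 by lia.
  exact: reaches_jump.
- rewrite /stable /= negb_or => /andP[/and4P[i1 j1 iw wf]] /andP[].
  rewrite !inE !negb_or => /and3P[_ ji jw] /hasPn hb.
  have st : stable c.
    rewrite /stable wf; apply/hasPn => l /hb; rewrite /= !inE !negb_or.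
    by case/and3P.
  move=> /code_at_cons[P0] /code_at_cons[P1] /code_at_cons[P2].
  move=> /code_at_cons[P3] /code_at_cons[P4] /code_at_cat[C].
  rewrite size_compile => /code_at_cons[P5 _].
  have e5 : p.+4.+1 = p + 5 by lia.
  rewrite e5 in C P5.
  rewrite addnA; apply: (@reaches_leq _ (1 + (1 + (s.1 j * (cost c s.1 + 4) + 1)))); first lia.
  apply: reaches_trans (reaches_exec s _ P0) _ => //.
  apply: reaches_trans (reaches_exec _ _ P1) _ => //.
  rewrite -/(loop_init i j s).
  have bnd : {in loop_bounds c, (loop_init i j s).1 =1 s.1}.
    move=> l /hb; case: s => r m /=; rewrite !inE !negb_or.
    by case/and3P=> /negPf -> /negPf ->.
  have e0 : (loop_init i j s).1 i = s.1 j.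
    by case: (s) => r m /=; rewrite eqxx (negPf j1) addn0.
  rewrite -(eq_cost bnd).
  (* Later iterations start from other states, so the induction on the counter keeps of the state
     only that register [i] holds [q]. *)
  move: (loop_init i j s) (s.1 j) e0 => {s bnd} s q.
  elim: q s => [|q IHq] s e0.
    by have := reaches_jump_zero s P2; rewrite e0 eqxx.
  have R2 := reaches_jump_zero s P2; rewrite e0 /= in R2.
  set s1 := loop_dec i s.
  have b1 : {in loop_bounds c, s1.1 =1 s.1}.
    move=> l /hb; rewrite /s1; case: (s) => r m /=; rewrite !inE !negb_or.
    by case/and3P=> /negPf -> /negPf ->.
  have b2 : {in loop_bounds c, (run c s1).1 =1 s.1}.
    move=> l lb; rewrite run_unwritten ?b1 //.
    by have := hb _ lb; rewrite /= !inE !negb_or; case/and3P.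
  have e1 : (run c s1).1 i = q.
    rewrite run_unwritten // /s1; case: (s) e0 => r m /=; rewrite eqxx (negPf i1) => ->.
    by rewrite subn1.
  apply: (@reaches_leq _
    (1 + (1 + (1 + (cost c s.1 + (1 + (q * (cost c s.1 + 4) + 1)))))));
    first lia.
  apply: reaches_trans R2 _.
  apply: reaches_trans (reaches_exec s _ P3) _ => //.
  apply: reaches_trans (reaches_exec _ _ P4) _ => //.
  rewrite -/(loop_dec i s) -/s1 e5 -(eq_cost b1).
  apply: reaches_trans (IH _ s1 st C) _.
  apply: reaches_trans (reaches_jump _ P5) _.
  have -> : p + 2 = p.+2 by lia.
  rewrite iterSr -/s1.
  have -> : cost c s1.1 = cost c (run c s1).1.
    by apply: eq_cost => l lb; rewrite b1 ?b2.
  exact: IHq.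
Qed.

(** The whole program is not [stable]: its setup computes the loop bounds of the later blocks. This
    lemma cuts it into stable blocks, each charged by the registers at its own start. *)
Lemma compile_seq_reaches P c1 c2 p s T v :
  stable c1 -> code_at P p (compile p (c1 ;; c2)) ->
  (code_at P (p + code_size c1) (compile (p + code_size c1) c2) ->
   reaches P T (config_at (p + code_size c1) (run c1 s)) v) ->
  reaches P (cost c1 s.1 + T) (config_at p s) v.
Proof.
move=> st1 /= /code_at_cat[]; rewrite size_compile => C1 C2 H.
by apply: reaches_trans (compile_correct s st1 C1) (H C2).
Qed.

Lemma run_loop_ind i j c (Inv : nat -> state -> Prop) s :
  Inv 0 (loop_init i j s) ->
  (forall q u, q < s.1 j -> Inv q u -> Inv q.+1 (run c (loop_dec i u))) ->
  Inv (s.1 j) (run (Loop i j c) s).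
Proof.
move=> I0 IS /=; have : s.1 j <= s.1 j by [].
by elim: {-2}(s.1 j) => //= q IH lt_q; apply: IS => //; apply/IH/ltnW.
Qed.

Lemma run_skip s : run Skip s = s. Proof. by []. Qed.
Lemma run_op a s : run (Op a) s = exec a s. Proof. by []. Qed.
Lemma run_seq c1 c2 s : run (c1 ;; c2) s = run c2 (run c1 s). Proof. by []. Qed.
Lemma run_if i c1 c2 s :
  run (IfZero i c1 c2) s = if s.1 i == 0 then run c1 s else run c2 s.
Proof. by []. Qed.

Definition runE := (run_skip, run_op, run_seq, run_if).

Arguments run : simpl never.

(** * Splitting and merging the classes of an equivalence relation *)

Section Equivalences.
Variable V : finType.
Implicit Types (R : rel V) (A : {set V}).

Definition eqclass R (v : V) : {set V} := [set u | R v u].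

(* Counts elements rather than classes, so that it can be read off the vertex
   degrees without division. *)
Definition class_hist R (s : nat) : nat := #|[set v | #|eqclass R v| == s]|.

(* Counts ordered pairs, hence twice the number of edits. *)
Definition rel_dist R R' : nat := #|[set p : V * V | R p.1 p.2 != R' p.1 p.2]|.

Definition refine A R : rel V := fun u w => R u w && ((u \in A) == (w \in A)).

Lemma eq_class_hist R R' : R =2 R' -> class_hist R =1 class_hist R'.
Proof.
move=> eqR s; apply: eq_card => v; rewrite !inE.
by congr (_ == s); apply: eq_card => u; rewrite !inE eqR.
Qed.

Lemma eq_rel_distr R R' R1 : R =2 R' -> rel_dist R1 R = rel_dist R1 R'.
Proof. by move=> eqR; apply: eq_card => p; rewrite !inE eqR. Qed.

Lemma rel_distC R R' : rel_dist R R' = rel_dist R' R.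
Proof. by apply: eq_card => p; rewrite !inE eq_sym. Qed.

Lemma rel_dist_triangle R2 R1 R3 :
  rel_dist R1 R3 <= rel_dist R1 R2 + rel_dist R2 R3.
Proof.
apply: leq_trans (leq_card_setU _ _); apply: subset_leq_card.
apply/subsetP => p; rewrite !inE.
by case: (R1 _ _) (R2 _ _) (R3 _ _) => [] [] [].
Qed.

(** Wherever [R] and [R'] differ, [R'] already has its final value, so no pair is changed twice on
    the way to [R1] and the triangle inequality becomes an equality. *)
Lemma rel_dist_between R R' R1 :
  (forall u w, R u w != R' u w -> R1 u w = R' u w) ->
  rel_dist R R1 = rel_dist R R' + rel_dist R' R1.
Proof.
move=> btw; rewrite /rel_dist -cardsUI.
rewrite [X in _ = _ + X](_ : _ = 0) ?addn0.
  apply: eq_card => p; rewrite !inE; move: (btw p.1 p.2).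
  by case: (R _ _) (R' _ _) (R1 _ _) => [] [] [] //= /(_ isT).
apply/eqP; rewrite cards_eq0; apply/eqP/setP => p; rewrite !inE.
move: (btw p.1 p.2).
by case: (R _ _) (R' _ _) (R1 _ _) => [] [] [] //= /(_ isT).
Qed.

Lemma rel_dist_eq0 R R' : rel_dist R R' = 0 -> R =2 R'.
Proof.
move/eqP; rewrite cards_eq0 => /eqP e u w.
by move/setP: e => /(_ (u, w)); rewrite !inE /= => /negbFE/eqP.
Qed.

Lemma refine_equiv A R : equivalence_rel R -> equivalence_rel (refine A R).
Proof.
move=> eR u v w; rewrite /refine; split; first by rewrite (eR w w w).1 eqxx.
by case/andP=> Ruv /eqP ->; rewrite (eR u v w).2.
Qed.

Section Refine.
Variables (R : rel V) (v : V) (A : {set V}).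
Hypotheses (eR : equivalence_rel R) (sA : A \subset eqclass R v).

Let C := eqclass R v.

Lemma equivalence_sym u w : R u w = R w u.
Proof.
by apply/idP/idP => H; [rewrite -(eR u w u).2 | rewrite -(eR w u w).2];
  rewrite ?(eR u u u).1 ?(eR w w w).1.
Qed.

Lemma card_eqclass_refine u :
  #|eqclass (refine A R) u| =
    if u \in A then #|A| else if u \in C then #|C :\: A| else #|eqclass R u|.
Proof.
have inC w : (w \in C) = R v w by rewrite inE.
have AC w : w \in A -> R v w by move/(subsetP sA); rewrite inE.
case: ifPn => uA; last case: ifPn => uC.
- apply: eq_card => w; rewrite inE /refine uA.
  by case wA: (w \in A); rewrite ?andbF ?andbT // -(eR v u w).2 ?AC.
- apply: eq_card => w; rewrite !inE /refine (negPf uA).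
  by case wA: (w \in A); rewrite ?andbF ?andbT // -(eR v u w).2 // -inC.
- apply: eq_card => w; rewrite !inE /refine (negPf uA).
  case wA: (w \in A); rewrite ?andbF ?andbT //; apply/esym/negbTE.
  apply: contra uC => Ruw; by rewrite inE (eR v w u).2 ?AC // equivalence_sym.
Qed.

Lemma card_eqclass_in u : u \in C -> #|eqclass R u| = #|C|.
Proof.
by rewrite inE => Rvu; apply: eq_card => w; rewrite !inE -(eR v u w).2.
Qed.

Lemma card_set_const (S : {set V}) (f : V -> nat) c s :
  {in S, forall u, f u = c} -> #|[set u in S | f u == s]| = (c == s) * #|S|.
Proof.
move=> fc; case: eqP => [<-|/eqP ne].
  rewrite mul1n; apply: eq_card => u; rewrite !inE.
  by case uS: (u \in S) => //=; rewrite fc ?eqxx.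
rewrite mul0n; apply/eqP; rewrite cards_eq0; apply/eqP/setP => u; rewrite !inE.
by case uS: (u \in S) => //=; rewrite fc // (negPf ne).
Qed.

Lemma class_hist_split s :
  class_hist R s = (#|C| == s) * #|C| + #|[set u | #|eqclass R u| == s] :\: C|.
Proof.
rewrite /class_hist -(cardsID C); congr (_ + _).
rewrite -(card_set_const s card_eqclass_in); apply: eq_card => u.
by rewrite !inE andbC.
Qed.

(** The entry of [C] is traded for those of its two parts. The terms are arranged without
    subtraction, which would truncate, and the formula also covers parts of equal size and empty
    parts. *)
Lemma class_hist_refine s :
  class_hist (refine A R) s + (#|C| == s) * #|C| =
  class_hist R s + (#|A| == s) * #|A| + (#|C :\: A| == s) * #|C :\: A|.
Proof.
rewrite class_hist_split /class_hist -(cardsID C) -(cardsID A).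
rewrite (_ : _ :&: C :&: A = [set u in A | #|eqclass (refine A R) u| == s]); last first.
  apply/setP => u; rewrite !inE; case uA: (u \in A); rewrite ?andbF //= ?andbT.
  by have := subsetP sA u uA; rewrite inE => ->; rewrite andbT.
rewrite (@card_set_const _ _ #|A|); last by move=> u uA; rewrite card_eqclass_refine uA.
rewrite (_ : _ :&: C :\: A = [set u in C :\: A | #|eqclass (refine A R) u| == s]); last first.
  by apply/setP => u; rewrite !inE [in RHS]andbC andbCA andbC -!andbA.
rewrite (@card_set_const _ _ #|C :\: A|); last first.
  by move=> u; rewrite card_eqclass_refine in_setD => /andP[/negPf -> ->].
rewrite (_ : _ :\: C = [set u | #|eqclass R u| == s] :\: C); first lia.
apply/setP => u; rewrite in_setD [in RHS]in_setD; case uC: (u \in C) => //=.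
rewrite [in LHS]in_set [in RHS]in_set card_eqclass_refine uC.
by case: ifPn => // uA; have := subsetP sA u uA; rewrite -/C uC.
Qed.

Lemma rel_dist_refine : rel_dist R (refine A R) = (#|A| * #|C :\: A|).*2.
Proof.
rewrite /rel_dist -addnn -{1}cardsX mulnC -cardsX -cardsUI.
rewrite [X in _ = _ + X](_ : _ = 0) ?addn0; last first.
  apply/eqP; rewrite cards_eq0; apply/eqP/setP => -[u w]; rewrite !inE /=.
  by case: (u \in A); rewrite ?andbF.
apply: eq_card => -[u w]; rewrite !inE /= /refine.
have AC x : x \in A -> R v x by move/(subsetP sA); rewrite inE.
case uA: (u \in A); case wA: (w \in A) => //=; rewrite ?andbT ?andbF ?orbF ?eqxx //=.
- by rewrite -(eR v u w).2; [case: (R v w) | apply: AC].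
- by rewrite equivalence_sym -(eR v w u).2; [case: (R v u) | apply: AC].
Qed.

End Refine.

Definition coarsen (a b : V) R : rel V := fun u w =>
  R u w || [&& R a u || R b u & R a w || R b w].

Section Coarsen.
Variables (R : rel V) (a b : V).
Hypotheses (eR : equivalence_rel R) (Nab : ~~ R a b).

Lemma coarsen_equiv : equivalence_rel (coarsen a b R).
Proof.
move=> u v w; rewrite /coarsen; split; first by rewrite (eR w w w).1.
case/orP=> [Ruv|/andP[Uu Uv]].
  rewrite (eR u v w).2 // (equivalence_sym eR a u) (equivalence_sym eR b u).
  by rewrite (eR u v a).2 // (eR u v b).2 // !(equivalence_sym eR v).
rewrite Uu Uv /=.
have H x : R a x || R b x -> R x w -> R a w || R b w.
  by case/orP=> Rx Rxw; [rewrite (eR a x w).2 ?Rxw | rewrite (eR b x w).2 ?Rxw ?orbT].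
case: (boolP (R a w || R b w)); rewrite ?orbT ?orbF // => Nw.
by rewrite (contraNF (H u Uu)) ?(contraNF (H v Uv)).
Qed.

(** A merge is undone by splitting the merged class along one of the two old ones; hence the size
    and distance formulas for merges follow from those for splits. *)
Lemma refine_coarsen : refine (eqclass R a) (coarsen a b R) =2 R.
Proof.
move=> u w; rewrite /refine /coarsen !inE.
case Ruw: (R u w).
  by rewrite (equivalence_sym eR a u) (equivalence_sym eR a w) (eR u w a).2 //= eqxx.
case au: (R a u); case aw: (R a w); rewrite ?andbF ?andbT //=.
  by rewrite -Ruw -(eR a u w).2.
case bu: (R b u); case bw: (R b w) => //=.
by rewrite -Ruw -(eR b u w).2.
Qed.

Lemma eqclass_coarsenD :
  eqclass (coarsen a b R) a :\: eqclass R a = eqclass R b.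
Proof.
apply/setP => u; rewrite !inE /coarsen (eR a a a).1 /=.
case au: (R a u) => //=; apply/esym/negbTE.
by apply: contra Nab => bu; rewrite (eR a u b).2 // (equivalence_sym eR).
Qed.

Lemma sub_eqclass_coarsen : eqclass R a \subset eqclass (coarsen a b R) a.
Proof. by apply/subsetP => u; rewrite !inE /coarsen => ->. Qed.

Lemma card_eqclass_coarsen :
  #|eqclass (coarsen a b R) a| = #|eqclass R a| + #|eqclass R b|.
Proof.
rewrite -eqclass_coarsenD -(cardsID (eqclass R a) (eqclass (coarsen a b R) a)).
by congr (#|pred_of_set _| + _); apply/setIidPr/sub_eqclass_coarsen.
Qed.

Lemma class_hist_coarsen s :
  let x := #|eqclass R a| in let y := #|eqclass R b| in
  class_hist R s + (x + y == s) * (x + y) =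
  class_hist (coarsen a b R) s + (x == s) * x + (y == s) * y.
Proof.
rewrite /= -(eq_class_hist refine_coarsen).
have := class_hist_refine coarsen_equiv sub_eqclass_coarsen s.
by rewrite eqclass_coarsenD card_eqclass_coarsen.
Qed.

Lemma rel_dist_coarsen :
  rel_dist R (coarsen a b R) = (#|eqclass R a| * #|eqclass R b|).*2.
Proof.
rewrite rel_distC -(eq_rel_distr _ refine_coarsen).
by rewrite (rel_dist_refine coarsen_equiv sub_eqclass_coarsen) eqclass_coarsenD.
Qed.

End Coarsen.

Lemma class_hist_gt0 R s : 0 < class_hist R s -> exists v, #|eqclass R v| = s.
Proof. by rewrite card_gt0 => /set0Pn[v]; rewrite inE => /eqP <-; exists v. Qed.

Lemma class_hist_large R s : #|V| < s -> class_hist R s = 0.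
Proof.
move=> lt_s; apply/eqP; rewrite -leqn0 leqNgt; apply/negP => /class_hist_gt0[v e].
by have := max_card (mem (eqclass R v)); rewrite e leqNgt lt_s.
Qed.

Lemma class_hist0 R : equivalence_rel R -> class_hist R 0 = 0.
Proof.
move=> eR; apply/eqP; rewrite -leqn0 leqNgt; apply/negP => /class_hist_gt0[v].
by move/eqP; rewrite cards_eq0 => /eqP/setP/(_ v); rewrite !inE (eR v v v).1.
Qed.

End Equivalences.

(** * Certificates *)

Definition withdraw (v : nat) (D : nat -> nat) : nat -> nat := upd D v (D v - v).
Definition deposit (v : nat) (D : nat -> nat) : nat -> nat := upd D v (D v + v).

Record cert_state := CertState {
  cleft : nat; cright : nat; spent : nat; fault : nat; hist : nat -> nat }.

(* Digits 0 and 1 enter the sizes x and y of two parts in unary, paying x * y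
   on the way; digit 2 splits a cluster of size x + y into parts of sizes x and
   y, any other digit merges clusters of sizes x and y.  A nonzero fault records
   a missing cluster. *)
Definition cert_step (st : cert_state) (d : nat) : cert_state :=
  let: CertState x y c b D := st in
  match d with
  | 0 => CertState x.+1 y (c + y) b D
  | 1 => CertState x y.+1 (c + x) b D
  | 2 =>
    let b1 := b + (x + y - D (x + y)) in
    let D1 := withdraw (x + y) D in
    CertState 0 0 c b1 (if b1 == 0 then deposit y (deposit x D1) else D1)
  | _ =>
    let b1 := b + (x - D x) in
    let D1 := withdraw x D in
    let b2 := b1 + (y - D1 y) in
    let D2 := withdraw y D1 in
    CertState 0 0 c b2 (if b2 == 0 then deposit (x + y) D2 else D2)
  end.

Lemma cert_step_lefts x y c b D n :
  foldl cert_step (CertState x y c b D) (nseq n 0) =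
  CertState (x + n) y (c + n * y) b D.
Proof.
elim: n x c => [|n IH] x c /=; first by rewrite !addn0.
by rewrite IH; congr CertState; lia.
Qed.

Lemma cert_step_rights x y c b D n :
  foldl cert_step (CertState x y c b D) (nseq n 1) =
  CertState x (y + n) (c + n * x) b D.
Proof.
elim: n y c => [|n IH] y c /=; first by rewrite !addn0.
by rewrite IH; congr CertState; lia.
Qed.

Lemma depositE v D s : deposit v D s = D s + (v == s) * v.
Proof. by rewrite /deposit /= eq_sym; case: eqP => [->|]; rewrite ?mul1n ?addn0. Qed.

Lemma withdrawE v D s : withdraw v D s = D s - (v == s) * v.
Proof. by rewrite /withdraw /= eq_sym; case: eqP => [->|]; rewrite ?mul1n ?subn0. Qed.

Lemma split_hist D x y s : x + y <= D (x + y) ->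
  deposit y (deposit x (withdraw (x + y) D)) s + (x + y == s) * (x + y) =
  D s + (x == s) * x + (y == s) * y.
Proof.
rewrite !depositE withdrawE; case: (eqVneq (x + y) s) => [->|_]; last by lia.
by rewrite !mul1n; lia.
Qed.

(** The second hypothesis looks at the histogram after the first withdrawal, so that x = y requires
    two clusters of that size. *)
Lemma merge_hist D x y s : x <= D x -> y <= withdraw x D y ->
  D s + (x + y == s) * (x + y) =
  deposit (x + y) (withdraw y (withdraw x D)) s + (x == s) * x + (y == s) * y.
Proof.
rewrite depositE !withdrawE; case: (eqVneq x s) => [->|n1].
  by case: (eqVneq y s) => [->|n2]; rewrite ?eqxx !mul1n; lia.
by case: (eqVneq y s) => [->|n2]; rewrite ?(negPf n1) ?mul1n ?mul0n; lia.
Qed.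

Section Certificates.
Variable V : finType.
Implicit Types (R : rel V) (st : cert_state).

(** The product [cleft st * cright st] is paid as the sizes are entered, before the step that uses
    it; the last clause accounts for this prepayment. *)
Definition realizes R0 st R : Prop :=
  [/\ equivalence_rel R, hist st =1 class_hist R &
      rel_dist R0 R + (cleft st * cright st).*2 <= (spent st).*2].

(** The first clause survives faults. It keeps nonzero values inside the cells for sizes up to
    [#|V|], and it is the reason why [cert_step] deposits nothing once a fault has occurred. *)
Definition cert_inv R0 st : Prop :=
  (forall s, #|V| < s -> hist st s = 0) /\
  (fault st = 0 -> exists R, realizes R0 st R).

Lemma realizes_split R0 x y c D R :
  realizes R0 (CertState x y c 0 D) R -> x + y <= D (x + y) ->
  exists R', realizes R0
    (CertState 0 0 c 0 (deposit y (deposit x (withdraw (x + y) D)))) R'.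
Proof.
move=> [/= eR DR dR] le_z.
(* An arbitrary string may split size 0; there may be no class to choose then, and the relation
   stays as it is. *)
have [/eqP|z_gt0] := posnP (x + y).
  rewrite addn_eq0 => /andP[/eqP x0 /eqP y0]; subst; exists R; split=> //=.
  by move=> s; rewrite !depositE withdrawE !muln0 !addn0 subn0.
have [v ev] : exists v, #|eqclass R v| = x + y.
  by apply: class_hist_gt0; rewrite -DR (leq_trans z_gt0).
(* Any x elements of the class will do, as only sizes are tracked. *)
have [A sA cA] : exists2 A : {set V}, A \subset eqclass R v & #|A| = x.
  have : x <= #|eqclass R v| by rewrite ev leq_addr.
  case/card_geqP=> s [us ss sC].
  exists [set u in s]; last by rewrite cardsE (card_uniqP us).
  by apply/subsetP => u; rewrite inE => /sC.
have cCA : #|eqclass R v :\: A| = y by rewrite cardsD (setIidPr sA) ev cA addKn.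
exists (refine A R); split; first exact: refine_equiv.
- move=> s /=; have := split_hist s le_z; have := class_hist_refine eR sA s.
  by rewrite cA cCA ev DR; lia.
- have := rel_dist_triangle R R0 (refine A R).
  by rewrite (rel_dist_refine eR sA) cA cCA /=; lia.
Qed.

Lemma realizes_merge R0 x y c D R :
  realizes R0 (CertState x y c 0 D) R -> x <= D x -> y <= withdraw x D y ->
  exists R', realizes R0
    (CertState 0 0 c 0 (deposit (x + y) (withdraw y (withdraw x D)))) R'.
Proof.
move=> [/= eR DR dR] le_x le_y.
have [x0|x_gt0] := posnP x.
  subst; exists R; split=> //=.
  by move=> s; have := merge_hist s le_x le_y; rewrite add0n DR; lia.
have [y0|y_gt0] := posnP y.
  subst; exists R; split=> //=; last by lia.
  by move=> s; have := merge_hist s le_x le_y; rewrite addn0 DR; lia.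
have [a ea] : exists v, #|eqclass R v| = x.
  by apply: class_hist_gt0; rewrite -DR (leq_trans x_gt0).
(* With the class of [a] withdrawn at least y > 0 units remain in the entry of y, so some element
   outside that class lies in a class of size y, even when x = y. *)
have [b [eb Nab]] : exists b, #|eqclass R b| = y /\ ~~ R a b.
  have := class_hist_split a eR y; rewrite -DR ea => eD.
  have : 0 < #|[set u | #|eqclass R u| == y] :\: eqclass R a|.
    by move: le_y; rewrite withdrawE eD; lia.
  rewrite card_gt0 => /set0Pn[b]; rewrite !inE => /andP[Nab /eqP eb].
  by exists b.
exists (coarsen a b R); split; first exact: coarsen_equiv.
- move=> s /=; have := merge_hist s le_x le_y.
  by have := class_hist_coarsen eR Nab s; rewrite /= ea eb DR; lia.
- have := rel_dist_triangle R R0 (coarsen a b R).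
  by rewrite (rel_dist_coarsen eR Nab) ea eb /=; lia.
Qed.

Lemma cert_inv_step R0 st d : cert_inv R0 st -> cert_inv R0 (cert_step st d).
Proof.
case: st => x y c b D [/= small real].
case: d => [|[|[|d]]] /=.
- by split=> // /real[R [eR DR dR]]; exists R; split=> //=; move: dR => /=; lia.
- by split=> // /real[R [eR DR dR]]; exists R; split=> //=; move: dR => /=; lia.
- have [e0|ne0] := eqVneq (b + (x + y - D (x + y))) 0; last first.
    split=> /= [s lt_s|/eqP]; last by rewrite (negPf ne0).
    by rewrite withdrawE small.
  have [b0 le_z] : b = 0 /\ x + y <= D (x + y) by lia.
  have [R HR] := real b0; subst b.
  have [R' HR'] := realizes_split HR le_z; rewrite e0 /=.
  split; last by exists R'.
  by case: HR' => /= _ DR' _ s lt_s; rewrite DR' class_hist_large.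
- set D1 := withdraw x D.
  have [e0|ne0] := eqVneq (b + (x - D x) + (y - D1 y)) 0; last first.
    split=> /= [s lt_s|/eqP]; last by rewrite (negPf ne0).
    by rewrite withdrawE /D1 withdrawE small.
  have [b0 [le_x le_y]] : b = 0 /\ x <= D x /\ y <= D1 y by lia.
  have [R HR] := real b0; subst b.
  have [R' HR'] := realizes_merge HR le_x le_y; rewrite e0 /=.
  split; last by exists R'.
  by case: HR' => /= _ DR' _ s lt_s; rewrite DR' class_hist_large.
Qed.

Lemma cert_inv_foldl R0 st ds :
  cert_inv R0 st -> cert_inv R0 (foldl cert_step st ds).
Proof. by elim: ds st => //= d ds IH st inv; apply/IH/cert_inv_step. Qed.

Lemma cert_inv_init R0 D : equivalence_rel R0 -> D =1 class_hist R0 ->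
  cert_inv R0 (CertState 0 0 0 0 D).
Proof.
move=> eR DR; split=> /= [s lt_s|_]; first by rewrite DR class_hist_large.
exists R0; split=> //=; rewrite addn0 leqn0 cards_eq0; apply/eqP/setP => p.
by rewrite !inE eqxx.
Qed.

Definition op_code x y (d : nat) := nseq x 0 ++ nseq y 1 ++ [:: d].

Lemma foldl_op_code x y d c D :
  foldl cert_step (CertState 0 0 c 0 D) (op_code x y d) =
  cert_step (CertState x y (c + x * y) 0 D) d.
Proof.
rewrite /op_code !foldl_cat cert_step_lefts cert_step_rights /=.
by rewrite !add0n muln0 addn0 mulnC.
Qed.

(** Positive x and y satisfy x + y <= 2 * x * y, and the closing digit costs at most another x * y:
    this is where three digits per edit come from. *)
Lemma size_op_code x y d : 0 < x -> 0 < y -> size (op_code x y d) <= 3 * (x * y).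
Proof. by rewrite !size_cat !size_nseq /=; nia. Qed.

(** If some class of [R] meets several classes of [R1], its part in one of them is cut off;
    otherwise [R] refines [R1] strictly, and two classes inside one class of [R1] are merged. All
    pairs changed thereby get their value in [R1], so [rel_dist_between] applies. *)
Lemma certificate_step R R1 : equivalence_rel R -> equivalence_rel R1 ->
  ~ R =2 R1 ->
  exists x y d R', [/\ 0 < x, 0 < y, equivalence_rel R',
    rel_dist R R1 = (x * y).*2 + rel_dist R' R1 &
    forall D c, D =1 class_hist R -> exists2 D', D' =1 class_hist R' &
      cert_step (CertState x y c 0 D) d = CertState 0 0 c 0 D'].
Proof.
move=> eR eR1 neR.
case: (pickP [pred p : V * V | R p.1 p.2 && ~~ R1 p.1 p.2]) => [[v u] /= /andP[Rvu N1vu]|sub].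
  pose A := eqclass R v :&: eqclass R1 v.
  have sA : A \subset eqclass R v by apply: subsetIl.
  have x_gt0 : 0 < #|A|.
    by apply/card_gt0P; exists v; rewrite !inE (eR v v v).1 (eR1 v v v).1.
  have y_gt0 : 0 < #|eqclass R v :\: A|.
    by apply/card_gt0P; exists u; rewrite !inE Rvu N1vu.
  have e : #|eqclass R v| = #|A| + #|eqclass R v :\: A|.
    by rewrite -(cardsID A); congr (_ + _); rewrite (setIidPr sA).
  exists #|A|, #|eqclass R v :\: A|, 2, (refine A R).
  split=> //; first exact: refine_equiv.
    rewrite -(rel_dist_refine eR sA); apply: rel_dist_between => a b.
    rewrite /refine; case Rab: (R a b); rewrite ?eqxx //= => ne.
    apply/idP/idP; last by move=> E; rewrite E in ne.
    move=> R1ab; move: ne; rewrite !inE.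
    rewrite (equivalence_sym eR v a) (eR a b v).2 // (equivalence_sym eR b v).
    by rewrite (equivalence_sym eR1 v a) (eR1 a b v).2 // (equivalence_sym eR1 b v) eqxx.
  move=> D c DR /=; rewrite -e.
  have le_z : #|eqclass R v| <= D #|eqclass R v|.
    by rewrite DR (class_hist_split v eR) eqxx mul1n leq_addr.
  rewrite (eqP le_z) /=; eexists; last by [].
  move=> s; have := class_hist_refine eR sA s.
  rewrite e in le_z *.
  by have := split_hist s le_z; rewrite DR; lia.
case: (pickP [pred p : V * V | R1 p.1 p.2 && ~~ R p.1 p.2])
  => [[a b] /= /andP[R1ab Nab]|sup]; last first.
  case: neR => u w; move: (sub (u, w)) (sup (u, w)) => /=.
  by case: (R u w) (R1 u w) => [] [].
have subR u w : R u w -> R1 u w.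
  by move=> Ruw; have := sub (u, w); rewrite /= Ruw => /negbFE.
exists #|eqclass R a|, #|eqclass R b|, 3, (coarsen a b R); split.
- by apply/card_gt0P; exists a; rewrite inE (eR a a a).1.
- by apply/card_gt0P; exists b; rewrite inE (eR b b b).1.
- exact: coarsen_equiv.
- rewrite -(rel_dist_coarsen eR Nab); apply: rel_dist_between => u w.
  rewrite /coarsen; case Ruw: (R u w); rewrite ?eqxx //=.
  case: (boolP (_ && _)) => [/andP[Uu Uw] _|]; last by rewrite eqxx.
  have H x : R a x || R b x -> R1 a x.
    by case/orP=> [/subR //|/subR R1bx]; rewrite (eR1 a b x).2.
  by rewrite -(eR1 a u w).2 ?H.
move=> D c DR /=; set x := #|eqclass R a|; set y := #|eqclass R b|.
have ha s := class_hist_split a eR s; have hb s := class_hist_split b eR s.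
have le_x : x <= D x by rewrite DR ha eqxx mul1n leq_addr.
have le_y : y <= withdraw x D y.
  rewrite withdrawE DR ha -/x.
  have : y <= #|[set u | #|eqclass R u| == y] :\: eqclass R a|.
    apply/subset_leq_card/subsetP => u; rewrite !inE => Rbu.
    rewrite (contraNN _ Nab) /=; last first.
      by move=> Rau; rewrite (eR a u b).2 // (equivalence_sym eR).
    by apply/eqP/(card_eqclass_in eR); rewrite inE.
  by lia.
rewrite (eqP le_x) (eqP le_y) /=; eexists; last by [].
move=> s; have := merge_hist s le_x le_y.
by have := class_hist_coarsen eR Nab s; rewrite /= -/x -/y DR; lia.
Qed.

Lemma certificate_exists R R1 : equivalence_rel R -> equivalence_rel R1 ->
  exists ds e, [/\ e.*2 = rel_dist R R1, size ds <= 3 * e &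
    forall D c, D =1 class_hist R -> exists2 D', D' =1 class_hist R1 &
      foldl cert_step (CertState 0 0 c 0 D) ds = CertState 0 0 (c + e) 0 D'].
Proof.
have [N] := ubnP (rel_dist R R1).
elim: N R => // N IH R lt_N eR eR1.
have [d0|d_gt0] := posnP (rel_dist R R1).
  exists [::], 0; split=> // D c DR; exists D; last by rewrite addn0.
  by move=> s; rewrite DR; apply/eq_class_hist/rel_dist_eq0.
have neR : ~ R =2 R1.
  move=> eqR; move: d_gt0; rewrite card_gt0 => /set0Pn[p].
  by rewrite inE eqR eqxx.
have [x [y [d [R' [x_gt0 y_gt0 eR' eN HD]]]]] := certificate_step eR eR1 neR.
have [|ds [e [ee sz Hds]]] := IH R' _ eR' eR1; first by nia.
exists (op_code x y d ++ ds), (x * y + e); split.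
- by rewrite eN -ee doubleD.
- by rewrite size_cat mulnDr leq_add ?size_op_code.
- move=> D c DR; rewrite foldl_cat foldl_op_code.
  have [D1 D1R ->] := HD D (c + x * y) DR.
  by have [D2 D2R ->] := Hds D1 (c + x * y) D1R; exists D2; rewrite ?addnA.
Qed.

(** One inequality suffices, as [s] and [s'] range over both orders. *)
Definition hist_balanced eta (D : nat -> nat) : Prop :=
  forall s s', 0 < D s -> 0 < D s' -> s <= s' + eta.

Definition cert_accepts k eta st : Prop :=
  [/\ fault st = 0, spent st <= k & hist_balanced eta (hist st)].

Theorem certificateP R0 D k eta : equivalence_rel R0 -> D =1 class_hist R0 ->
  (exists2 ds, size ds = 3 * k &
     cert_accepts k eta (foldl cert_step (CertState 0 0 0 0 D) ds)) <->
  (exists R, [/\ equivalence_rel R, rel_dist R0 R <= k.*2 &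
     hist_balanced eta (class_hist R)]).
Proof.
move=> eR0 DR; split.
  move=> [ds _ [f0 le_k bal]].
  have [_ /(_ f0)[R [eR hR dR]]] := cert_inv_foldl ds (cert_inv_init eR0 DR).
  exists R; split=> //; first by lia.
  by move=> s s'; rewrite -!hR; apply: bal.
move=> [R [eR dR bal]].
have [ds [e [ee sz H]]] := certificate_exists eR0 eR.
have [D' D'R eD'] := H D 0 DR.
(* Padding with digit 0 is free: the description ends with both sizes at 0, and enlarging x costs y
   = 0. *)
exists (ds ++ nseq (3 * k - size ds) 0).
  by rewrite size_cat size_nseq; lia.
rewrite foldl_cat eD' cert_step_lefts; split=> //=; first by lia.
by move=> s s'; rewrite !D'R; apply: bal.
Qed.

End Certificates.

(** * Cluster graphs as equivalence relations *)

Section ClusterGraphs.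
Variable V : finType.
Implicit Types (R : rel V) (E F : {set {set V}}).

Lemma adj_sym E : symmetric (adj E).
Proof. by move=> x y; rewrite /adj setUC. Qed.

Lemma adjxx E x : E \subset vpairs V -> adj E x x = false.
Proof.
move=> sE; apply/negP => /(subsetP sE).
by rewrite inE setUid cards1.
Qed.

Lemma adj_symdiff E F x y : adj (symdiff E F) x y = (adj E x y != adj F x y).
Proof. by rewrite /adj !inE; case: (_ \in E) (_ \in F) => [] []. Qed.

Lemma symdiffK E F : symdiff E (symdiff E F) = F.
Proof. by apply/setP => A; rewrite !inE; case: (A \in E) (A \in F) => [] []. Qed.

Lemma symdiff_vpairs E F :
  E \subset vpairs V -> F \subset vpairs V -> symdiff E F \subset vpairs V.
Proof.
move=> sE sF; rewrite subUset !(subset_trans (subsetDl _ _)) //.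
Qed.

Lemma connect_adj_equiv E : equivalence_rel (connect (adj E)).
Proof.
move=> x y z; split=> // cxy; apply/idP/idP; last exact: connect_trans.
by apply: connect_trans; rewrite (sym_connect_sym (adj_sym E)).
Qed.

Lemma componentsE E : components E = [set eqclass (connect (adj E)) x | x : V].
Proof. by []. Qed.

Lemma cluster_connect E : cluster_graph E ->
  forall x y, connect (adj E) x y = (x == y) || adj E x y.
Proof.
move=> clE x y; apply/idP/orP => [cxy|[/eqP -> //|/connect1 //]].
case: (eqVneq x y) => [|ne]; [by left | right].
by apply: (clE (eqclass (connect (adj E)) x)); rewrite ?imset_f ?inE.
Qed.

Definition edges_of R : {set {set V}} :=
  [set [set p.1; p.2] | p : V * V & R p.1 p.2 && (p.1 != p.2)].

Lemma edges_of_vpairs R : edges_of R \subset vpairs V.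
Proof.
apply/subsetP => A /imsetP[p]; rewrite inE => /andP[_ ne] ->.
by rewrite inE cards2 ne.
Qed.

Lemma eq_set2 (a b c d : V) :
  [set a; b] = [set c; d] -> a = c /\ b = d \/ a = d /\ b = c.
Proof.
move=> e.
have ha : a \in [set c; d] by rewrite -e set21.
have hb : b \in [set c; d] by rewrite -e set22.
have hc : c \in [set a; b] by rewrite e set21.
have hd : d \in [set a; b] by rewrite e set22.
move: ha hb hc hd; rewrite !inE.
by case/orP=> /eqP e1 /orP[]/eqP e2 /orP[]/eqP e3 /orP[]/eqP e4; subst; auto.
Qed.

Lemma adj_edges_of R : equivalence_rel R ->
  forall x y, adj (edges_of R) x y = R x y && (x != y).
Proof.
move=> eR x y; apply/imsetP/idP => [[[a b]]|H]; last by exists (x, y); rewrite ?inE.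
rewrite inE /= => H /eq_set2[[-> ->] //|[-> ->]].
by rewrite (equivalence_sym eR) eq_sym.
Qed.

Lemma connect_edges_of R : equivalence_rel R -> connect (adj (edges_of R)) =2 R.
Proof.
move=> eR x y; apply/idP/idP => [/connectP[p pth ->]|Rxy]; last first.
  case: (eqVneq x y) => [-> //|ne]; apply: connect1.
  by rewrite adj_edges_of // Rxy.
elim: p x pth => /= [|z p IH] x; first by rewrite (eR x x x).1.
by rewrite adj_edges_of // => /andP[/andP[Rxz _] /IH]; rewrite (eR x z _).2.
Qed.

Lemma cluster_edges_of R : equivalence_rel R -> cluster_graph (edges_of R).
Proof.
move=> eR H; rewrite componentsE => /imsetP[v _ ->] x y.
rewrite !inE !connect_edges_of // adj_edges_of // => Rvx Rvy ->.
by rewrite -(eR v x y).2 ?Rvy.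
Qed.

(** The ordered pairs are grouped by the edge they span, two for each edge. *)
Lemma card_ordered_pairs F : F \subset vpairs V ->
  #|[set p : V * V | adj F p.1 p.2]| = #|F|.*2.
Proof.
move=> sF; rewrite -sum1_card.
rewrite (partition_big (fun p : V * V => [set p.1; p.2]) (mem F)) /=; last first.
  by move=> p; rewrite inE.
rewrite -muln2 -sum_nat_const; apply: eq_bigr => A AF.
have := subsetP sF A AF; rewrite inE => /cards2P[a [b [ne eA]]].
rewrite sum1_card -[RHS](_ : #|[set (a, b); (b, a)]| = 2); last first.
  by rewrite cards2 xpair_eqE negb_and ne.
apply: eq_card => -[u w]; rewrite !inE !xpair_eqE /=.
apply/andP/orP => [[_ /eqP]|].
  by rewrite eA => /eq_set2[[/= -> ->]|[/= -> ->]]; rewrite !eqxx; auto.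
by case=> /andP[/eqP-> /eqP->]; rewrite inE /adj /= ?[[set b; a]]setUC -eA.
Qed.

(** In a cluster graph connectivity is adjacency plus the diagonal, so two connectivity relations
    differ exactly on the ordered pairs spanning an edited edge. *)
Lemma rel_dist_edits E E' : E \subset vpairs V -> E' \subset vpairs V ->
  cluster_graph E -> cluster_graph E' ->
  rel_dist (connect (adj E)) (connect (adj E')) = #|symdiff E E'|.*2.
Proof.
move=> sE sE' clE clE'; rewrite -card_ordered_pairs ?symdiff_vpairs //.
apply: eq_card => -[x y]; rewrite !inE /= !cluster_connect // adj_symdiff.
by case: (eqVneq x y) => [->|] //; rewrite !adjxx.
Qed.

Lemma balanced_hist E eta :
  balanced eta E <-> hist_balanced eta (class_hist (connect (adj E))).
Proof.
rewrite /balanced componentsE; split=> [bal s s'|bal H H'].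
  move=> /class_hist_gt0[x <-] /class_hist_gt0[y <-].
  have := bal (eqclass (connect (adj E)) x) (eqclass (connect (adj E)) y).
  by rewrite !imset_f // => /(_ isT isT); lia.
have pos x : 0 < class_hist (connect (adj E)) #|eqclass (connect (adj E)) x|.
  by apply/card_gt0P; exists x; rewrite inE.
move=> /imsetP[x _ ->] /imsetP[y _ ->].
by have := bal _ _ (pos x) (pos y); have := bal _ _ (pos y) (pos x); lia.
Qed.

Lemma eq_hist_balanced eta D D' :
  D =1 D' -> hist_balanced eta D -> hist_balanced eta D'.
Proof. by move=> eD bal s s'; rewrite -!eD; apply: bal. Qed.

(** Taking the symmetric difference with [E] exchanges edit sets and target graphs, and target
    cluster graphs are equivalence relations up to the diagonal. *)
Lemma balanced_cluster_editingE E k eta :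
  E \subset vpairs V -> cluster_graph E ->
  balanced_cluster_editing E k eta <->
  (exists R, [/\ equivalence_rel R, rel_dist (connect (adj E)) R <= k.*2 &
     hist_balanced eta (class_hist R)]).
Proof.
move=> sE clE; split=> [[F [sF leF clF /balanced_hist bal]]|[R [eR dR bal]]].
  exists (connect (adj (symdiff E F))); split=> //; first exact: connect_adj_equiv.
  by rewrite rel_dist_edits ?symdiff_vpairs // symdiffK leq_double.
have clR := cluster_edges_of eR; have sR := edges_of_vpairs R.
exists (symdiff E (edges_of R)); rewrite symdiffK; split=> //.
- exact: symdiff_vpairs.
- rewrite -leq_double -rel_dist_edits //.
  by rewrite (eq_rel_distr _ (connect_edges_of eR)).
- apply/balanced_hist; apply: eq_hist_balanced bal => s.
  by apply/esym/eq_class_hist/connect_edges_of.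
Qed.

(** This spares the program a search for components: cluster sizes are row sums of the matrix plus
    one. *)
Lemma card_eqclass_degree E x : E \subset vpairs V -> cluster_graph E ->
  #|eqclass (connect (adj E)) x| = (sumn [seq nat_of_bool (adj E x y) | y <- enum V]).+1.
Proof.
move=> sE clE; rewrite sumnE big_map big_enum /= -big_mkcond /= sum1_card.
rewrite (cardsD1 x) inE connect0 add1n; congr _.+1; apply: eq_card => y.
rewrite !inE cluster_connect // -[RHS]/(adj E x y).
by case: (eqVneq y x) => [->|] //=; rewrite adjxx.
Qed.

End ClusterGraphs.

(** * The program *)

(* Registers: 0 answer, 1 scratch, 2 n, 3 k, 4 eta, 5 constant 0, 6 constant 1,
   8 number L of digits, 9 4^L, 10 base address of the histogram, 11 n + 1,
   12 current certificate, 13 its unread digits, 14 and 15 the sizes x and y,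
   16 cost so far, 17 fault, 20-22 loop counters, 23 matrix pointer, 24 degree
   plus one, 25 smallest cluster size seen, 26 current cluster size, 27 x + y,
   7, 18 and 19 temporaries.  Every certificate gets a fresh histogram at a
   higher base address, so nothing has to be erased. *)
Definition copy_reg i j := Op (IAdd i j 5).

Definition c_row :=
  copy_reg 24 6 ;;
  Loop 22 2 (Op (IRead 18 23) ;; Op (IAdd 24 24 18) ;; Op (IAdd 23 23 6)) ;;
  Op (IAdd 7 10 24) ;; Op (IRead 18 7) ;; Op (IAdd 18 18 6) ;; Op (IWrite 7 18).

Definition c_hist := Op (IConst 23 3) ;; Loop 21 2 c_row.

Definition c_withdraw v :=
  Op (IAdd 7 10 v) ;; Op (IRead 18 7) ;; Op (ISub 19 v 18) ;;
  Op (IAdd 17 17 19) ;; Op (ISub 18 18 v) ;; Op (IWrite 7 18).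

Definition c_deposit v :=
  Op (IAdd 7 10 v) ;; Op (IRead 18 7) ;; Op (IAdd 18 18 v) ;; Op (IWrite 7 18).

Definition c_clear := Op (IConst 14 0) ;; Op (IConst 15 0).

Definition c_left := Op (IAdd 16 16 15) ;; Op (IAdd 14 14 6).
Definition c_right := Op (IAdd 16 16 14) ;; Op (IAdd 15 15 6).
Definition c_split :=
  Op (IAdd 27 14 15) ;; c_withdraw 27 ;;
  IfZero 17 (c_deposit 14 ;; c_deposit 15) Skip ;; c_clear.
Definition c_merge :=
  Op (IAdd 27 14 15) ;; c_withdraw 14 ;; c_withdraw 15 ;;
  IfZero 17 (c_deposit 27) Skip ;; c_clear.

(** Register 18 becomes 0 exactly when what remains is still at least 4^L; at most three such
    subtractions determine a digit. *)
Definition c_next := Op (ISub 13 13 9) ;; Op (ISub 18 9 13).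

Definition c_digit :=
  Op (IAdd 13 13 13) ;; Op (IAdd 13 13 13) ;; Op (ISub 18 9 13) ;;
  IfZero 18
    (c_next ;; IfZero 18
       (c_next ;; IfZero 18 (c_next ;; c_merge) c_split)
       c_right)
    c_left.

Definition c_cert :=
  copy_reg 13 12 ;; c_clear ;; Op (IConst 16 0) ;; Op (IConst 17 0) ;;
  Loop 21 8 c_digit.

(** Sizes are scanned in increasing order, so each is compared only with the first one that occurs;
    0 in register 25 means that none has occurred yet. *)
Definition c_size :=
  Op (IAdd 26 26 6) ;; Op (IAdd 7 10 26) ;; Op (IRead 18 7) ;;
  IfZero 18 Skip
    (IfZero 25 (copy_reg 25 26) Skip ;;
     Op (ISub 18 26 25) ;; Op (ISub 18 18 4) ;; Op (IAdd 17 17 18)).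

Definition c_balance := Op (IConst 25 0) ;; Op (IConst 26 0) ;; Loop 21 2 c_size.

Definition c_accept :=
  Op (ISub 18 16 3) ;; Op (IAdd 17 17 18) ;;
  IfZero 17 (Op (IConst 0 1)) Skip ;; Op (IAdd 12 12 6) ;; Op (IAdd 10 10 11).

Definition c_body := c_hist ;; c_cert ;; c_balance ;; c_accept.

Definition c_setup :=
  Op (IConst 7 0) ;; Op (IRead 2 7) ;; Op (IConst 7 1) ;; Op (IRead 3 7) ;;
  Op (IConst 7 2) ;; Op (IRead 4 7) ;; Op (IConst 6 1) ;;
  Op (IAdd 8 3 3) ;; Op (IAdd 8 8 3) ;; Op (IConst 9 1) ;;
  Op (IConst 10 3) ;; Op (IAdd 11 2 6).

Definition c_power := Loop 20 8 (Op (IAdd 9 9 9) ;; Op (IAdd 9 9 9)).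
Definition c_base := Loop 20 2 (Op (IAdd 10 10 2)).
Definition c_search := Loop 20 9 c_body.
Definition c_program := c_setup ;; (c_power ;; c_base) ;; c_search.

(** * Effect of the program pieces on registers and memory *)

Definition mem_rep b (m0 D m : nat -> nat) : Prop :=
  (forall a, a < b -> m a = m0 a) /\ (forall v, m (b + v) = D v).

Lemma mem_rep_upd b m0 D m v c :
  mem_rep b m0 D m -> mem_rep b m0 (upd D v c) (upd m (b + v) c).
Proof.
move=> [lo hi]; split=> [a lt_a|u] /=; last by rewrite eqn_add2l hi.
by rewrite lo // ifN_eq //; lia.
Qed.


Lemma run_withdraw b m0 D s v : v \notin [:: 7; 17; 18; 19] ->
  s.1 10 = b -> mem_rep b m0 D s.2 ->
  let u := run (c_withdraw v) s in
  mem_rep b m0 (withdraw (s.1 v) D) u.2 /\ u.1 17 = s.1 17 + (s.1 v - D (s.1 v)).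
Proof.
rewrite !inE !negb_or => /and4P[/negPf e7 /negPf e17 /negPf e18 /negPf e19] eb rep.
rewrite !runE /= e7 e18 e17 e19 /= ?e7 ?e17 ?e18 ?e19 eb.
rewrite rep.2; split=> //; exact: mem_rep_upd.
Qed.

Lemma run_deposit b m0 D s v : v \notin [:: 7; 18] ->
  s.1 10 = b -> mem_rep b m0 D s.2 ->
  mem_rep b m0 (deposit (s.1 v) D) (run (c_deposit v) s).2.
Proof.
rewrite !inE !negb_or => /andP[/negPf e7 /negPf e18] eb rep.
rewrite !runE /= e7 e18 eb rep.2; exact: mem_rep_upd.
Qed.

Definition cert_rep b m0 st (s : state) : Prop :=
  [/\ s.1 14 = cleft st, s.1 15 = cright st, s.1 16 = spent st,
      s.1 17 = fault st & s.1 10 = b /\ mem_rep b m0 (hist st) s.2].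

Lemma run_left b m0 st s : s.1 6 = 1 -> cert_rep b m0 st s ->
  cert_rep b m0 (cert_step st 0) (run c_left s).
Proof.
case: st => x y c f D one [/= ex ey ec ef rep].
by rewrite /cert_rep !runE /= one ex ey ec addn1.
Qed.

Lemma run_right b m0 st s : s.1 6 = 1 -> cert_rep b m0 st s ->
  cert_rep b m0 (cert_step st 1) (run c_right s).
Proof.
case: st => x y c f D one [/= ex ey ec ef rep].
by rewrite /cert_rep !runE /= one ex ey ec addn1.
Qed.

Lemma run_clear b m0 x y c f D s : cert_rep b m0 (CertState x y c f D) s ->
  cert_rep b m0 (CertState 0 0 c f D) (run c_clear s).
Proof. by case=> /= ex ey ec ef rep; split. Qed.

Lemma run_split b m0 st s : cert_rep b m0 st s ->
  cert_rep b m0 (cert_step st 2) (run c_split s).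
Proof.
case: st => x y c f D [/= ex ey ec ef [eb rep]].
rewrite /c_split 3!run_seq.
set s1 := run (Op (IAdd 27 14 15)) s.
have e27 : s1.1 27 = x + y by rewrite /= ex ey.
have [e14 e15 e16] : [/\ s1.1 14 = x, s1.1 15 = y & s1.1 16 = c] by [].
have [e17 e10 {}rep] : [/\ s1.1 17 = f, s1.1 10 = b & mem_rep b m0 D s1.2] by [].
move: s1 e27 e14 e15 e16 e17 e10 rep => {ex ey ec ef eb}s e27 e14 e15 e16 e17 e10 rep.
(* The resulting state is about to be replaced by a variable, so the fact that other registers keep
   their values is saved beforehand. *)
move: (fun j => @run_unwritten (c_withdraw 27) s j).
case: (@run_withdraw b m0 D s 27 isT e10 rep).
rewrite e27 e17; move: (run _ s) => s2 rep2 e17' k2.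
have e10' : s2.1 10 = b by rewrite k2.
apply: (@run_clear _ _ x y); rewrite run_if e17'.
case: eqP => [f0|/eqP/negPf nf0]; last by split=> //=; rewrite ?run_skip ?k2.
rewrite run_seq.
move: (fun j => @run_unwritten (c_deposit 14) s2 j).
move: (@run_deposit b m0 _ s2 14 isT e10' rep2).
rewrite k2 // e14; move: (run _ s2) => s3 rep3 k3.
have e10'' : s3.1 10 = b by rewrite k3.
have := @run_deposit b m0 _ s3 15 isT e10'' rep3.
rewrite k3 // k2 // e15 => rep4.
by split; rewrite ?run_unwritten // ?k3 // ?k2.
Qed.

Lemma run_merge b m0 st s : cert_rep b m0 st s ->
  cert_rep b m0 (cert_step st 3) (run c_merge s).
Proof.
case: st => x y c f D [/= ex ey ec ef [eb rep]].
rewrite /c_merge 4!run_seq.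
set s1 := run (Op (IAdd 27 14 15)) s.
have e27 : s1.1 27 = x + y by rewrite /= ex ey.
have [e14 e15 e16] : [/\ s1.1 14 = x, s1.1 15 = y & s1.1 16 = c] by [].
have [e17 e10 {}rep] : [/\ s1.1 17 = f, s1.1 10 = b & mem_rep b m0 D s1.2] by [].
move: s1 e27 e14 e15 e16 e17 e10 rep => {ex ey ec ef eb}s e27 e14 e15 e16 e17 e10 rep.
move: (fun j => @run_unwritten (c_withdraw 14) s j).
case: (@run_withdraw b m0 D s 14 isT e10 rep).
rewrite e14 e17; move: (run _ s) => s2 rep2 e17' k2.
have e10' : s2.1 10 = b by rewrite k2.
move: (fun j => @run_unwritten (c_withdraw 15) s2 j).
case: (@run_withdraw b m0 _ s2 15 isT e10' rep2).
rewrite e17' k2 // e15; move: (run _ s2) => s3 rep3 e17'' k3.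
apply: (@run_clear _ _ x y); rewrite run_if e17''.
case: eqP => [f0|/eqP/negPf nf0]; last by split=> //; rewrite run_skip ?k3 // ?k2.
have e10'' : s3.1 10 = b by rewrite k3.
have := @run_deposit b m0 _ s3 27 isT e10'' rep3.
rewrite k3 // k2 // e27 => rep4.
by split; rewrite ?run_unwritten // ?k3 // ?k2.
Qed.

(** Long division against a fixed modulus: for M = 4 ^ L and w < M these are the base 4 digits of w,
    leading digit first. Each takes a quadrupling and comparisons with M, which the machine can do
    by additions and subtractions. *)
Fixpoint digits M L w : seq nat :=
  if L is L'.+1 then (4 * w %/ M) :: digits M L' (4 * w %% M) else [::].

Lemma run_digit b m0 st s M w :
  w < M -> s.1 6 = 1 -> s.1 9 = M -> s.1 13 = w -> cert_rep b m0 st s ->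
  cert_rep b m0 (cert_step st (4 * w %/ M)) (run c_digit s) /\
  (run c_digit s).1 13 = 4 * w %% M.
Proof.
move=> lt_w e6 e9 e13 rep; rewrite /c_digit 3!run_seq.
set s1 := run (Op (ISub 18 9 13)) _.
have f6 : s1.1 6 = 1 by [].
have f9 : s1.1 9 = M by [].
have f13 : s1.1 13 = 4 * w by rewrite /= e13; lia.
have f18 : s1.1 18 = M - 4 * w by rewrite /= e13 e9; lia.
have {}rep : cert_rep b m0 st s1 by [].
move: s1 f6 f9 f13 f18 rep => {e6 e9 e13}s e6 e9 e13 e18 rep.
have M_gt0 : 0 < M by lia.
have next u j : u.1 6 = 1 -> u.1 9 = M -> u.1 13 = j -> cert_rep b m0 st u ->
  let u' := run c_next u in [/\ u'.1 6 = 1, u'.1 9 = M, u'.1 13 = j - M,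
    u'.1 18 = M - (j - M) & cert_rep b m0 st u'].
  by move=> h6 h9 h13 hr; split=> //=; rewrite ?h9 ?h13.
have quo d : d * M <= 4 * w -> 4 * w < d.+1 * M ->
    4 * w %/ M = d /\ 4 * w %% M = 4 * w - d * M.
  move=> h1 h2; have -> : 4 * w = d * M + (4 * w - d * M) by lia.
  by rewrite divnMDl // modnMDl divn_small ?modn_small ?addn0; lia.
rewrite run_if e18; case: eqP => c1; last first.
  have [-> ->] : 4 * w %/ M = 0 /\ 4 * w %% M = 4 * w by have := quo 0; lia.
  by split; [apply: run_left | rewrite run_unwritten].
rewrite run_seq; have := next s _ e6 e9 e13 rep.
move: (run c_next s) => {e6 e9 e13 e18 rep}s [e6 e9 e13 e18 rep].
rewrite run_if e18; case: eqP => c2; last first.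
  have [-> ->] : 4 * w %/ M = 1 /\ 4 * w %% M = 4 * w - M by have := quo 1; lia.
  by split; [apply: run_right | rewrite run_unwritten].
rewrite run_seq; have := next s _ e6 e9 e13 rep.
move: (run c_next s) => {e6 e9 e13 e18 rep}s [e6 e9 e13 e18 rep].
rewrite run_if e18; case: eqP => c3; last first.
  have [-> ->] : 4 * w %/ M = 2 /\ 4 * w %% M = 4 * w - M - M by have := quo 2; lia.
  by split; [apply: run_split | rewrite run_unwritten].
rewrite run_seq; have := next s _ e6 e9 e13 rep.
move: (run c_next s) => {e6 e9 e13 e18 rep}s [e6 e9 e13 e18 rep].
have [-> ->] : 4 * w %/ M = 3 /\ 4 * w %% M = 4 * w - M - M - M by have := quo 3; lia.
by split; [apply: run_merge | rewrite run_unwritten].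
Qed.

Lemma run_cert b m0 s M D W L :
  W < M -> s.1 5 = 0 -> s.1 6 = 1 -> s.1 9 = M -> s.1 12 = W -> s.1 8 = L ->
  s.1 10 = b -> mem_rep b m0 D s.2 ->
  cert_rep b m0 (foldl cert_step (CertState 0 0 0 0 D) (digits M L W)) (run c_cert s).
Proof.
move=> lt_W e5 e6 e9 e12 e8 e10 rep; rewrite /c_cert 4!run_seq.
set s1 := run (Op (IConst 17 0)) _.
have e8' : s1.1 8 = L by [].
pose final := foldl cert_step (CertState 0 0 0 0 D) (digits M L W).
(* The invariant looks forward: processing the unread digits from the current state yields the final
   state. *)
pose Inv q (u : state) := [/\ u.1 6 = 1, u.1 9 = M & exists w st,
  [/\ w < M, u.1 13 = w, cert_rep b m0 st u &
      foldl cert_step st (digits M (L - q) w) = final]].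
suff : Inv (s1.1 8) (run (Loop 21 8 c_digit) s1).
  rewrite e8'; case=> _ _ [w [st [_ _ r]]]; rewrite subnn -/final => <-; exact: r.
apply: run_loop_ind.
  split=> //; exists W, (CertState 0 0 0 0 D).
  by rewrite subn0; split=> //=; rewrite e5 addn0.
rewrite e8' => q u lt_q [u6 u9 [w [st [lt_w u13 r ef]]]].
have r' : cert_rep b m0 st (loop_dec 21 u) by [].
have [r2 w2] := @run_digit b m0 st (loop_dec 21 u) M w lt_w u6 u9 u13 r'.
split; [by rewrite run_unwritten | by rewrite run_unwritten |].
exists (4 * w %% M), (cert_step st (4 * w %/ M)); split=> //.
  by rewrite ltn_mod; lia.
have e : L - q = (L - q.+1).+1 by lia.
by move: ef; rewrite e.
Qed.

Lemma run_row s row (n := size row) : s.1 5 = 0 -> s.1 6 = 1 -> s.1 2 = n ->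
  (forall j, j < n -> s.2 (s.1 23 + j) = nth 0 row j) ->
  let u := run c_row s in
  let a := s.1 10 + (sumn row).+1 in
  u.2 = upd s.2 a (s.2 a + 1) /\ u.1 23 = s.1 23 + n.
Proof.
move=> e5 e6 e2 rd; rewrite /c_row 2!run_seq.
set s1 := run (copy_reg 24 6) s.
pose Inv q (u : state) := [/\ u.2 = s.2, u.1 6 = 1, u.1 10 = s.1 10,
  u.1 23 = s.1 23 + q & u.1 24 = (sumn (take q row)).+1].
have : Inv (s1.1 2) (run (Loop 22 2
    (Op (IRead 18 23) ;; Op (IAdd 24 24 18) ;; Op (IAdd 23 23 6))) s1).
  apply: run_loop_ind => [|q u].
    by split=> //=; rewrite ?take0 ?addn0 //= e6 e5.
  rewrite [s1.1 2]e2 => lt_q [um u6 u10 u23 u24]; split=> //.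
    by rewrite !runE /= u23 u6; lia.
  rewrite !runE /= u24 um u23 rd //.
  by rewrite (take_nth 0) // sumn_rcons; lia.
rewrite [s1.1 2]e2 /Inv take_size; move: (run _ s1) => {s1}u [um u6 u10 u23 u24].
by rewrite !runE /= u10 u24 um u6 u23.
Qed.

Definition row_hist (rows : seq (seq nat)) (v : nat) : nat :=
  count (fun row => (sumn row).+1 == v) rows.

Lemma run_hist b m0 s rows (n := size rows) : s.1 5 = 0 -> s.1 6 = 1 ->
  s.1 2 = n -> s.1 10 = b -> 3 + n * n <= b ->
  (forall a, a < b -> s.2 a = m0 a) -> (forall a, b <= a -> s.2 a = 0) ->
  all (fun row => size row == n) rows ->
  (forall q j, q < n -> j < n -> m0 (3 + q * n + j) = nth 0 (nth [::] rows q) j) ->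
  mem_rep b m0 (row_hist rows) (run c_hist s).2.
Proof.
move=> e5 e6 e2 e10 le_b lo hi /all_nthP sz lay; rewrite /c_hist run_seq.
set s1 := run (Op _) s.
pose Inv q (u : state) := [/\ u.1 5 = 0, u.1 6 = 1, u.1 2 = n &
  [/\ u.1 10 = b, u.1 23 = 3 + q * n & mem_rep b m0 (row_hist (take q rows)) u.2]].
suff : Inv (s1.1 2) (run (Loop 21 2 c_row) s1).
  by rewrite [s1.1 2]e2 /Inv take_size => -[_ _ _ [_ _]].
apply: run_loop_ind => [|q u].
  split=> //; split=> //; split=> [a /lo //|v]; rewrite take0 /=.
  by apply: hi; rewrite leq_addr.
rewrite [s1.1 2]e2 => lt_q [u5 u6 u2 [u10 u23 rep]].
pose row := nth [::] rows q.
have szr : size row = n by apply/eqP/sz.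
have rd j : j < n -> (loop_dec 21 u).2 ((loop_dec 21 u).1 23 + j) = nth 0 row j.
  move=> lt_j; rewrite [(loop_dec 21 u).2]/= [(loop_dec 21 u).1 23]/= u23 rep.1 ?lay //.
  by apply: leq_trans le_b; nia.
have [] := @run_row (loop_dec 21 u) row u5 u6 _ _.
- by rewrite szr.
- by rewrite szr.
move=> em e23; split; try by rewrite run_unwritten.
split; first by rewrite run_unwritten.
  by rewrite e23 szr [(loop_dec 21 u).1 23]/= u23 mulSn; lia.
rewrite em; set a := _ + _.
have -> : a = b + (sumn row).+1 by rewrite /a -u10.
have := mem_rep_upd (sumn row).+1 ((loop_dec 21 u).2 (b + (sumn row).+1) + 1) rep.
case=> l h; split; first exact: l.
move=> v; rewrite h /= rep.2 (take_nth [::]) // /row_hist -cats1 count_cat /= addn0.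
by rewrite eq_sym -/row; case: eqP => [->|_]; rewrite ?addn0.
Qed.

Lemma run_balance s n b eta D : s.1 5 = 0 -> s.1 6 = 1 -> s.1 2 = n ->
  s.1 10 = b -> s.1 4 = eta -> (forall v, s.2 (b + v) = D v) ->
  let u := run c_balance s in
  u.2 = s.2 /\ (u.1 17 = 0 <-> s.1 17 = 0 /\
    forall v v', 0 < v <= n -> 0 < v' <= n -> 0 < D v -> 0 < D v' -> v <= v' + eta).
Proof.
move=> e5 e6 e2 e10 e4 eD; rewrite /c_balance 2!run_seq.
set s1 := run (Op (IConst 26 0)) _.
(* Register 25 is 0 or the least size occurring up to [q]; the fault stays 0 as long as every size
   met is within [eta] of that least one. *)
pose Inv q (u : state) := [/\ u.2 = s.2, u.1 5 = 0 /\ u.1 6 = 1,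
  u.1 10 = b /\ u.1 4 = eta, u.1 26 = q &
  let f := u.1 25 in
  [/\ f = 0 -> forall v, 0 < v <= q -> D v = 0,
      0 < f -> 0 < f <= q /\ 0 < D f,
      0 < f -> forall v, 0 < v <= q -> 0 < D v -> f <= v &
      u.1 17 = 0 <-> s.1 17 = 0 /\ forall v, 0 < v <= q -> 0 < D v -> v <= f + eta]].
have : Inv (s1.1 2) (run (Loop 21 2 c_size) s1).
  apply: run_loop_ind => [|q u].
    split=> //; split=> //=; first by lia.
    by split=> [->|[]] //; split=> // v; lia.
  move=> _ [um [u5 u6] [u10 u4] u26 [I0 I1 I2 I3]].
  rewrite /c_size 3!run_seq.
  set u1 := run (Op (IRead 18 7)) _.
  have k18 : u1.1 18 = D q.+1 by rewrite /= u10 u26 u6 um addn1 eD.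
  have [m1 [k5 k6] [k10 k4]] : [/\ u1.2 = s.2, u1.1 5 = 0 /\ u1.1 6 = 1 &
    u1.1 10 = b /\ u1.1 4 = eta] by [].
  have k26 : u1.1 26 = q.+1 by rewrite /= u26 u6 addn1.
  have [k25 k17] : u1.1 25 = u.1 25 /\ u1.1 17 = u.1 17 by [].
  move: u1 k18 m1 k5 k6 k10 k4 k26 k25 k17 => u1 k18 m1 k5 k6 k10 k4 k26 k25 k17.
  have ext (Q : nat -> Prop) : (forall v, 0 < v <= q.+1 -> Q v) <->
      (forall v, 0 < v <= q -> Q v) /\ Q q.+1.
    split=> [H|[H Hq] v vq]; first by split=> [v vq|]; apply: H; lia.
    by have [->|ne] := eqVneq v q.+1; last by apply: H; lia.
  rewrite run_if k18; case: eqP => [D0|/eqP Dn0].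
    rewrite run_skip; split=> //; rewrite k25 k17; split.
    - by move=> f0; apply/ext; split=> //; apply: I0.
    - by move=> /I1; lia.
    - by move=> f0; apply/ext; split; [apply: I2 | rewrite D0].
    - by rewrite I3 ext D0; intuition.
  rewrite -lt0n in Dn0; rewrite run_seq run_if k25; case: eqP => [f0|/eqP].
    rewrite !runE; split=> //=; rewrite k26 k5 k17 addn0 ?subnn ?sub0n; split=> //.
    - by move=> _; split=> //; lia.
    - by move=> _ v vq Dv; case: (ltnP q v) => // le; rewrite I0 in Dv => //; lia.
    - rewrite addn0 I3; split=> -[s0 _]; split=> // v vq Dv; first by lia.
      by rewrite I0 in Dv.
  rewrite -lt0n => f_gt0.
  rewrite !runE; split=> //=; rewrite k26 k25 k17 k4; split.
  - by lia.
  - by move=> _; split; have := I1 f_gt0; lia.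
  - by move=> _; apply/ext; split; [apply: I2 | have := I1 f_gt0; lia].
  - rewrite ext; split.
      move=> e0; have /I3[? ?] : u.1 17 = 0 by lia.
      by split=> //; split=> // _; lia.
    move=> [s0 [H Hq]]; have -> : u.1 17 = 0 by apply/I3.
    by have := Hq Dn0; lia.
rewrite [s1.1 2]e2; move: (run _ s1) => {s1}u [um _ _ _ [I0 I1 I2 I3]].
split=> //; rewrite I3; split=> -[s0 H]; split=> //.
  move=> v v' vn vn' Dv Dv'.
  have f_gt0 : 0 < u.1 25 by rewrite lt0n; apply/eqP => /I0 f0; rewrite f0 in Dv.
  by have := H v vn Dv; have := I2 f_gt0 v' vn' Dv'; lia.
move=> v vn Dv.
have f_gt0 : 0 < u.1 25 by rewrite lt0n; apply/eqP => /I0 f0; rewrite f0 in Dv.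
by have [fn Df] := I1 f_gt0; apply: H.
Qed.

(** * The loop over all certificates *)

Section Search.
Variables (n k eta M L : nat) (rows : seq (seq nat)) (m0 : nat -> nat).

Let result w :=
  foldl cert_step (CertState 0 0 0 0 (row_hist rows)) (digits M L w).

Hypothesis size_rows : size rows = n.
Hypothesis size_row : all (fun row => size row == n) rows.
Hypothesis layout : forall q j, q < n -> j < n ->
  m0 (3 + q * n + j) = nth 0 (nth [::] rows q) j.
Hypothesis result_large : forall w v, n < v -> hist (result w) v = 0.
Hypothesis result0 : forall w, fault (result w) = 0 -> hist (result w) 0 = 0.

(** The cells between the matrix and the current base hold discarded histograms and are left
    unspecified; all cells from the base on are zero. *)
Definition search_inv q (u : state) : Prop :=
  [/\ [/\ u.1 5 = 0, u.1 6 = 1, u.1 2 = n & u.1 3 = k],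
      [/\ u.1 4 = eta, u.1 8 = L, u.1 9 = M, u.1 11 = n.+1 & u.1 12 = q],
      3 + n * n <= u.1 10 /\ (forall a, a < 3 + n * n -> u.2 a = m0 a),
      forall a, u.1 10 <= a -> u.2 a = 0 &
      exists2 ans : bool, u.1 0 = ans &
        ans <-> exists2 w, w < q & cert_accepts k eta (result w)].

Lemma run_body q u : q < M -> search_inv q u ->
  search_inv q.+1 (run c_body (loop_dec 20 u)).
Proof.
move=> lt_q [[u5 u6 u2 u3] [u4 u8 u9 u11 u12] [le_b lo] hi [ans u0 Hans]].
set s0 := loop_dec 20 u.
rewrite /c_body 3!run_seq.
have rep1 : mem_rep (u.1 10) u.2 (row_hist rows) (run c_hist s0).2.
  apply: run_hist => //; rewrite size_rows // => q' j lq lj.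
  by rewrite lo ?layout //; nia.
have h1 j : j \notin written c_hist -> j \notin [:: 1; 20] ->
    (run c_hist s0).1 j = u.1 j.
  move=> jw; rewrite !inE negb_or => /andP[/negPf j1 /negPf j20].
  by rewrite run_unwritten //= j20 j1.
move: (run c_hist s0) rep1 h1 => s1 rep1 h1.
have rep2 : cert_rep (u.1 10) u.2 (result q) (run c_cert s1).
  by apply: run_cert => //; rewrite h1.
have h2 j : j \notin written c_hist ++ written c_cert -> j \notin [:: 1; 20] ->
    (run c_cert s1).1 j = u.1 j.
  by rewrite mem_cat negb_or => /andP[? ?] ?; rewrite run_unwritten // h1.
move: (run c_cert s1) rep2 h2 => {s1 rep1 h1}s2 [_ _ e16 e17 [e10 rep2]] h2.
have b5 : s2.1 5 = 0 by rewrite h2.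
have b6 : s2.1 6 = 1 by rewrite h2.
have b2 : s2.1 2 = n by rewrite h2.
have b4 : s2.1 4 = eta by rewrite h2.
have [m3 H3] := run_balance b5 b6 b2 e10 b4 rep2.2.
have h3 j : j \notin (written c_hist ++ written c_cert) ++ written c_balance ->
    j \notin [:: 1; 20] -> (run c_balance s2).1 j = u.1 j.
  by rewrite mem_cat negb_or => /andP[? ?] ?; rewrite run_unwritten // h2.
have f16 : (run c_balance s2).1 16 = spent (result q) by rewrite run_unwritten.
move: (run c_balance s2) m3 H3 h3 f16 => s3 m3 H3 h3 f16.
have Hacc : s3.1 17 + (s3.1 16 - s3.1 3) = 0 <-> cert_accepts k eta (result q).
  rewrite f16 (h3 3) // u3; split.
    move=> e0; have /H3[] : s3.1 17 = 0 by lia.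
    rewrite e17 => f0 bal; split=> //; first by lia.
    (* The balance scan covers only the sizes 1 to n; a fault-free histogram has no others. *)
    have pos v : 0 < hist (result q) v -> 0 < v <= n.
      move=> hv; apply/andP; split.
        by rewrite lt0n; apply/eqP => v0; rewrite v0 result0 in hv.
      by rewrite leqNgt; apply/negP => /(@result_large q) v0; rewrite v0 in hv.
    by move=> v v' hv hv'; apply: bal => //; apply: pos.
  case=> f0 le_k bal; have -> : s3.1 17 = 0.
    by apply/H3; rewrite e17; split=> // v v' _ _; apply: bal.
  by lia.
(* The histogram occupies the n + 1 cells from its base, so the next base, n + 1 further on, finds
   zeros. *)
have small a : u.1 10 + n < a -> s3.2 a = 0.
  move=> lt_a; have -> : a = u.1 10 + (a - u.1 10) by lia.
  by rewrite m3 rep2.2 result_large //; lia.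
have low a : a < 3 + n * n -> s3.2 a = m0 a.
  by move=> lt_a; rewrite m3 rep2.1 ?lo //; lia.
have g10 : (run c_accept s3).1 10 = u.1 10 + n.+1.
  by rewrite !runE; case: ifP => _ /=; rewrite !h3 // u11.
have g2 : (run c_accept s3).2 = s3.2 by rewrite !runE; case: ifP.
split.
- by split; rewrite run_unwritten // h3.
- split; try by rewrite run_unwritten // h3.
  by rewrite !runE; case: ifP => _ /=; rewrite !h3 // u12 u6 addn1.
- by rewrite g10 g2; split=> //; lia.
- by rewrite g10 g2 => a le_a; apply: small; lia.
rewrite !runE.
exists ((s3.1 17 + (s3.1 16 - s3.1 3) == 0) || ans).
  by rewrite [X in X == 0]/=; case: ifP => _ //=; rewrite h3.
split=> [/orP[/eqP/Hacc|/Hans[w lt_w]]|[w]].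
- by exists q.
- by exists w => //; apply: ltnW.
rewrite ltnS leq_eqVlt => /orP[/eqP-> /Hacc -> //|lt_w acc].
by apply/orP; right; apply/Hans; exists w.
Qed.

Lemma run_search s : s.1 9 = M -> search_inv 0 s ->
  search_inv M (run c_search s).
Proof.
move=> e9 inv; rewrite -e9; apply: run_loop_ind.
  by case: inv => *; split.
by rewrite e9 => q u; apply: run_body.
Qed.

End Search.

Lemma run_power s : s.1 9 = 1 -> (run c_power s).1 9 = 4 ^ (s.1 8).
Proof.
move=> e9; apply: (run_loop_ind (Inv := fun q u => u.1 9 = 4 ^ q)) => //.
by move=> q u _ IH; rewrite !runE /= IH expnS; lia.
Qed.

Lemma run_base s : (run c_base s).1 10 = s.1 10 + s.1 2 * s.1 2.
Proof.
have [] : (fun q (u : state) => u.1 10 = s.1 10 + q * s.1 2 /\ u.1 2 = s.1 2)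
    (s.1 2) (run c_base s) => //.
apply: (run_loop_ind (Inv := fun q (u : state) =>
  u.1 10 = s.1 10 + q * s.1 2 /\ u.1 2 = s.1 2)) => [|q u _ [e10 e2]].
  by rewrite mul0n addn0.
by rewrite !runE /= e10 e2 mulSn; split=> //; lia.
Qed.

Lemma memory_power s : (run c_power s).2 = s.2.
Proof. exact: (run_loop_ind (Inv := fun _ u => u.2 = s.2)). Qed.

Lemma memory_base s : (run c_base s).2 = s.2.
Proof. exact: (run_loop_ind (Inv := fun _ u => u.2 = s.2)). Qed.

(** * Enumeration of digit strings by numbers *)

Fixpoint digits_val (ds : seq nat) : nat :=
  if ds is d :: ds' then d * 4 ^ size ds' + digits_val ds' else 0.

Lemma digits_val_lt ds : all (ltn^~ 4) ds -> digits_val ds < 4 ^ size ds.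
Proof.
elim: ds => //= d ds IH /andP[lt_d /IH]; rewrite expnS.
by move: (4 ^ size ds) => X; nia.
Qed.

(** The exponent [i] is there for the induction: once [i] digits are consumed, the modulus is
    unchanged while the remainder has been scaled by 4 ^ i. *)
Lemma digits_valK i ds : all (ltn^~ 4) ds ->
  digits (4 ^ (i + size ds)) (size ds) (digits_val ds * 4 ^ i) = ds.
Proof.
elim: ds i => //= d ds IH i /andP[lt_d ds4].
have -> : 4 * ((d * 4 ^ size ds + digits_val ds) * 4 ^ i) =
    d * 4 ^ (i + (size ds).+1) + digits_val ds * 4 ^ i.+1.
  by rewrite addnS !expnS expnD; lia.
have lt_v : digits_val ds * 4 ^ i.+1 < 4 ^ (i + (size ds).+1).
  by rewrite -addSnnS expnD mulnC ltn_pmul2l ?expn_gt0 // digits_val_lt.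
rewrite divnMDl ?expn_gt0 // modnMDl divn_small // modn_small // addn0.
by rewrite -addSnnS IH.
Qed.

Lemma size_digits M L w : size (digits M L w) = L.
Proof. by elim: L w => //= L IH w; rewrite IH. Qed.

Lemma foldl_cert_cap st ds :
  foldl cert_step st (map (minn 3) ds) = foldl cert_step st ds.
Proof.
elim: ds st => //= d ds IH st; rewrite IH; congr foldl.
by case: d st => [|[|[|[|d]]]] [].
Qed.

(** Certificates are strings of arbitrary naturals, whereas counting produces digits below 4.
    Capping at 3 closes the gap, since [cert_step] treats all digits above 2 alike. *)
Lemma digits_exhaust L (Q : seq nat -> Prop) :
  (forall ds, Q (map (minn 3) ds) <-> Q ds) ->
  (exists2 w, w < 4 ^ L & Q (digits (4 ^ L) L w)) <->
  (exists2 ds, size ds = L & Q ds).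
Proof.
move=> cap; split=> [[w _ Qw]|[ds <- /cap Qds]].
  by exists (digits (4 ^ L) L w); rewrite ?size_digits.
have ds4 : all (ltn^~ 4) (map (minn 3) ds).
  by rewrite all_map; apply/allP => d _ /=; rewrite gtn_min.
have := digits_val_lt ds4; have := digits_valK 0 ds4.
rewrite size_map add0n muln1 => e lt; eexists; first exact: lt.
by rewrite e.
Qed.

Lemma nth_flatten_rows n (rows : seq (seq nat)) q j :
  all (fun row => size row == n) rows -> j < n ->
  nth 0 (flatten rows) (q * n + j) = nth 0 (nth [::] rows q) j.
Proof.
elim: rows q => [|row rows IH] q /=; first by rewrite !nth_nil.
move=> /andP[/eqP szr sz] lt_j; rewrite nth_cat szr.
case: q => [|q] /=; first by rewrite lt_j.
by rewrite ltnNge mulSn -addnA leq_addr addKn IH.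
Qed.

Lemma outputs_within_reaches P x T p u (b : bool) :
  reaches P T (init x) (config_at p u) -> nth IHalt P p = IHalt -> u.1 0 = b ->
  outputs_within P x T b.
Proof.
move=> [t le_t e] halt u0; rewrite /outputs_within.
have fix_pt d : iter d (step P) (config_at p u) = config_at p u.
  by elim: d => //= d ->; rewrite /step /current halt.
by rewrite -(subnK le_t) iterD e fix_pt.
Qed.

Definition adjacency_rows (V : finType) (E : {set {set V}}) :=
  [seq [seq nat_of_bool (adj E x y) | y <- enum V] | x <- enum V].

Lemma row_hist_adjacency (V : finType) (E : {set {set V}}) :
  E \subset vpairs V -> cluster_graph E ->
  row_hist (adjacency_rows E) =1 class_hist (connect (adj E)).
Proof.
move=> sE clE v; rewrite /row_hist /adjacency_rows count_map /class_hist.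
rewrite -sum1_count big_enum_cond -sum1_card; apply: eq_bigl => x /=.
by rewrite !inE card_eqclass_degree.
Qed.

(** * Answer and running time of the whole program *)

Definition bce_program : program := compile 0 c_program.

(** Registers 2 and 8 hold n and the number of digits: reading the matrix is quadratic in n, the
    certificate linear in its length, the balance test linear in n. The factor 100 is generous. *)
Lemma cost_body r : cost c_body r <= 100 * ((r 2).+1 * (r 2).+1) * (r 8).+1.
Proof. by rewrite /=; move: (r 2) (r 8) => a b; nia. Qed.

Section Correctness.
Variables (V : finType) (E : {set {set V}}) (k eta : nat).

Let n := #|V|.
Let s0 : state := (fun=> 0, nth 0 (encode E k eta)).
Let s1 := run c_setup s0.
Let s2 := run (c_power ;; c_base) s1.

Lemma all_size_rows : all (fun row => size row == n) (adjacency_rows E).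
Proof. by rewrite all_map; apply/allP => x _ /=; rewrite size_map -cardE. Qed.

Lemma encode_flatten : encode E k eta = [:: n; k; eta] ++ flatten (adjacency_rows E).
Proof. by []. Qed.

Lemma size_flatten_rows : size (flatten (adjacency_rows E)) = n * n.
Proof.
rewrite size_flatten /shape sumnE big_map big_seq.
rewrite (eq_bigr (fun=> n)); last by move=> r /(allP all_size_rows)/eqP.
by rewrite -big_seq big_const_seq count_predT iter_addn_0 mulnC size_map -cardE.
Qed.

Lemma search_ready :
  search_inv n k eta (4 ^ (3 * k)) (3 * k) (adjacency_rows E) s0.2 0 s2.
Proof.
have eL : s1.1 8 = 3 * k by rewrite /= ; lia.
have m1 : s2.2 = s0.2 by rewrite /s2 run_seq memory_base memory_power.
have k1 j : j \notin written (c_power ;; c_base) -> s2.1 j = s1.1 j.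
  exact: run_unwritten.
have e10 : s2.1 10 = 3 + n * n.
  by rewrite /s2 run_seq run_base !(@run_unwritten c_power).
have e9 : s2.1 9 = 4 ^ (3 * k).
  by rewrite /s2 run_seq run_unwritten // run_power // eL.
split.
- by split; rewrite k1.
- split=> //; rewrite k1 //.
  by rewrite [LHS]/= addn1.
- by rewrite e10 m1.
(* The input has length 3 + n * n, and the memory beyond it is 0 by the default of [nth]. *)
- rewrite e10 m1 => a le_a; rewrite [s0.2]/= encode_flatten nth_default //.
  by rewrite size_cat size_flatten_rows.
by exists false; [rewrite k1 | split=> // -[]].
Qed.

Lemma bce_program_reaches :
  reaches bce_program
    (cost c_setup s0.1 + (cost (c_power ;; c_base) s1.1 + cost c_search s2.1))
    (init (encode E k eta)) (config_at (0 + code_size c_program) (run c_search s2)).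
Proof.
have code : code_at bce_program 0 (compile 0 c_program) by [].
rewrite -[init _]/(config_at 0 s0).
apply: (compile_seq_reaches _ code) => // C2.
apply: (compile_seq_reaches _ C2) => // C3.
exact: (@compile_correct _ c_search _ s2 isT C3).
Qed.

(** The single constant 300 serves as factor and as both exponents, and is not optimized; exponents
    9 * k and 2 would do for the dominant term, with factor 104, namely 100 for the body and 4 for
    the loop around it. *)
Lemma bce_program_time :
  cost c_setup s0.1 + (cost (c_power ;; c_base) s1.1 + cost c_search s2.1) <=
  300 * 2 ^ (300 * k) * n.+1 ^ 300.
Proof.
have [[_ _ e2 _] [_ e8 e9 _ _] _ _ _] := search_ready.
have f8 : s1.1 8 = 3 * k by rewrite /=; lia.
have f2 : s1.1 2 = n by [].
have -> : cost c_setup s0.1 = 12 by [].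
have -> : cost (c_power ;; c_base) s1.1 = 3 * k * 6 + 3 + (n * 5 + 3).
  by rewrite -f8 -f2.
have -> : cost c_search s2.1 = 4 ^ (3 * k) * (cost c_body s2.1 + 4) + 3.
  by rewrite -e9.
have := cost_body s2.1; rewrite e2 e8.
move: (cost c_body s2.1) => body le_body.
have leX d : d <= 300 -> 2 ^ (d * k) <= 2 ^ (300 * k).
  by move=> le_d; rewrite leq_exp2l // leq_mul2r le_d orbT.
have leY d : d <= 300 -> n.+1 ^ d <= n.+1 ^ 300.
  by move=> le_d; apply: leq_pexp2l.
have leA : 4 ^ (3 * k) * (3 * k).+1 <= 2 ^ (300 * k).
  (* There are 2 ^ (6 * k) certificates, and 3 * k + 1 <= 2 ^ (3 * k) absorbs their length. *)
  apply: leq_trans (leX 9 isT).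
  have -> : 9 * k = 2 * (3 * k) + 3 * k by lia.
  by rewrite expnD (expnM 2 2) leq_mul2l ltn_expl ?orbT.
have leN : n.+1 * n.+1 <= n.+1 ^ 300 by apply: leY 2 isT.
move: (n.+1 ^ 300) (2 ^ (300 * k)) leN leA {leX leY} => Y X leN leA.
have A_gt0 : 0 < 4 ^ (3 * k) by rewrite expn_gt0.
move: (4 ^ (3 * k)) A_gt0 leA => A A_gt0 leA.
have leAb : A * (body + 4) <= 104 * (X * Y).
  apply: (@leq_trans (104 * ((A * (3 * k).+1) * (n.+1 * n.+1)))).
    rewrite mulnCA -!mulnA leq_mul2l; apply/orP; right; nia.
  by rewrite leq_mul2l leq_mul.
have [le_k le_n] : (3 * k).+1 <= X /\ n.+1 <= Y by nia.
have [le1 le2] : X <= X * Y /\ Y <= X * Y by nia.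
by rewrite -[300 * X * Y]mulnA; move: (X * Y) leAb le1 le2 => Z; lia.
Qed.

Hypotheses (sE : E \subset vpairs V) (clE : cluster_graph E).

Lemma bce_program_answer :
  exists2 b : bool, (run c_search s2).1 0 = b &
    b <-> balanced_cluster_editing E k eta.
Proof.
have eH := row_hist_adjacency sE clE.
have eR := connect_adj_equiv E.
have inv ds := cert_inv_foldl ds (cert_inv_init eR eH).
have size_rows : size (adjacency_rows E) = n by rewrite size_map -cardE.
have layout q j : q < n -> j < n ->
    s0.2 (3 + q * n + j) = nth 0 (nth [::] (adjacency_rows E) q) j.
  by move=> _ lt_j; rewrite -addnA /= (nth_flatten_rows q all_size_rows).
have large w v : n < v -> hist (foldl cert_step
    (CertState 0 0 0 0 (row_hist (adjacency_rows E)))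
    (digits (4 ^ (3 * k)) (3 * k) w)) v = 0.
  by have [+ _] := inv (digits (4 ^ (3 * k)) (3 * k) w); apply.
have zero w : let st := foldl cert_step
    (CertState 0 0 0 0 (row_hist (adjacency_rows E)))
    (digits (4 ^ (3 * k)) (3 * k) w) in fault st = 0 -> hist st 0 = 0.
  move=> st f0; have [_ /(_ f0)[R [eRR hR _]]] := inv (digits (4 ^ (3 * k)) (3 * k) w).
  by rewrite hR class_hist0.
have ready := search_ready.
have e9 : s2.1 9 = 4 ^ (3 * k) by case: ready => _ [].
have [_ _ _ _ [b e0 Hb]] :=
  run_search size_rows all_size_rows layout large zero e9 ready.
exists b => //; rewrite Hb balanced_cluster_editingE // -(certificateP k eta eR eH).
apply: (@digits_exhaust _ (fun ds => cert_accepts k eta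
  (foldl cert_step (CertState 0 0 0 0 (row_hist (adjacency_rows E))) ds))).
by move=> ds; rewrite foldl_cert_cap.
Qed.

End Correctness.

Theorem mainTheorem6 :
  exists (P : program) (c : nat),
    forall (V : finType) (E : {set {set V}}) (k eta : nat),
      E \subset vpairs V -> cluster_graph E ->
      exists b : bool,
        (b <-> balanced_cluster_editing E k eta) /\
        outputs_within P (encode E k eta) (c * 2 ^ (c * k) * #|V|.+1 ^ c) b.
Proof.
exists bce_program, 300 => V E k eta sE clE.
have [b eb Hb] := bce_program_answer k eta sE clE.
exists b; split=> //.
apply: (outputs_within_reaches _ _ eb).
  exact: reaches_leq (@bce_program_time V E k eta) (@bce_program_reaches V E k eta).
(* Execution ends at the address just past the text, where the default of [nth] is [IHalt]. *)
by rewrite nth_default ?size_compile.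
Qed.
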